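(* There is an absolute constant $K$ such that the following holds. Let $n\in\mathbb{N}$, let $(X,Y)$ be a bivariate real random variable with bounded range, and let $K_1\ge 1$ satisfy $H_n(X)+H_n(Y)-H_n(X,Y)\le\log K_1$. Then there exists a random variable $(X'',Y',X',Y'')$ (with values in $\mathbb{R}^4$) such that: (i) $(X',Y')$ has the same distribution as $(X,Y)$; (ii) $X'$ and $X''$ are conditionally i.i.d. given $D_n(Y')$; (iii) $Y'$ and $Y''$ are conditionally i.i.d. given $D_n(X')$; (iv) $(X'',Y')$ and $Y''$ are conditionally independent given $D_n(X')$; in particular $X''$ and $Y''$ are conditionally independent given $D_n(X',Y')$. Moreover $$H_n(X''\mid X',Y')\ge H_n(X)-\log K_1,\qquad H_n(Y''\mid X',Y')\ge H_n(Y)-\log K_1.$$ In addition, for any $\kappa\ge2$, any $K_2\ge1$, and any weakly $\kappa$-bi-Lipschitz real functions $f,g$ (with domains containing the ranges) satisfying $H_n(f(X)+g(Y))-\frac{H_n(X)+H_n(Y)}{2}\le\log K_2$, we have $$H_n(f(X'')+g(Y'')\mid X',Y')-\frac{H_n(X)+H_n(Y)}{2}\le 4\log K_1+3\log K_2+K\log\kappa.$$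
   Context: Logarithms base 2. $D_n(x)=\lfloor 2^nx\rfloor/2^n$ coordinatewise. $H_n(W):=H(D_n(W))$ (Shannon entropy of the discretization), $H_n(X,Y):=H(D_n(X),D_n(Y))$, and $H_n(A\mid B):=H(D_n(A)\mid D_n(B))$, where $H(U\mid V)=\sum_v P(V=v)H(U\mid V=v)$. A function $f$ is weakly $\kappa$-bi-Lipschitz if it is $\kappa$-Lipschitz and its domain decomposes into boundedly many (absolute constant) pieces on each of which $f$ is injective with $\kappa$-Lipschitz inverse. *)

(* Defs.v *)
From HB Require Import structures.
From mathcomp Require Import all_boot all_order all_algebra.
From mathcomp Require Import all_classical all_reals all_analysis.
Set Implicit Arguments. Unset Strict Implicit. Unset Printing Implicit Defensive.
Import Order.TTheory GRing.Theory Num.Theory.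
Local Open Scope classical_set_scope.
Local Open Scope ring_scope.

Section Defs.
Variable R : realType.

(* logarithm base 2 (note: ln 0 = 0 in the library, so p*log2 p = 0 at p=0) *)
Definition log2 (x : R) : R := ln x / ln 2.

Definition Dn (n : nat) (x : R) : R := (Num.floor (2 ^+ n * x))%:~R / 2 ^+ n.

Context d (T : measurableType d) (P : probability T R).

Definition pr (A : set T) : R := fine (P A).

Definition entropy (V : choiceType) (U : T -> V) : \bar R :=
  \esum_(v in [set: V]) (- pr [set w | U w = v] * log2 (pr [set w | U w = v]))%:E.

Definition entropy_given (V W : choiceType) (U : T -> V) (C : T -> W) (c : W) : \bar R :=
  \esum_(u in [set: V])
    (let q := pr [set w | U w = u /\ C w = c] / pr [set w | C w = c] in - q * log2 q)%:E.

Definition cond_entropy (V W : choiceType) (U : T -> V) (C : T -> W) : \bar R :=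
  \esum_(c in [set: W]) ((pr [set w | C w = c])%:E * entropy_given U C c)%E.

Definition Hn (n : nat) (X : T -> R) : \bar R := entropy (fun w => Dn n (X w)).
Definition Hn2 (n : nat) (X Y : T -> R) : \bar R :=
  entropy (fun w => (Dn n (X w), Dn n (Y w))).
Definition Hn_cond (n : nat) (A : T -> R) (B : T -> R) : \bar R :=
  cond_entropy (fun w => Dn n (A w)) (fun w => Dn n (B w)).
Definition Hn_cond2 (n : nat) (A : T -> R) (B1 B2 : T -> R) : \bar R :=
  cond_entropy (fun w => Dn n (A w)) (fun w => (Dn n (B1 w), Dn n (B2 w))).

Definition cond_indep d1 d2 (S1 : measurableType d1) (S2 : measurableType d2)
  (W : Type) (U1 : T -> S1) (U2 : T -> S2) (C : T -> W) : Prop :=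
  forall (c : W) (A1 : set S1) (A2 : set S2), measurable A1 -> measurable A2 ->
    pr [set w | U1 w \in A1 /\ U2 w \in A2 /\ C w = c] * pr [set w | C w = c] =
    pr [set w | U1 w \in A1 /\ C w = c] * pr [set w | U2 w \in A2 /\ C w = c].

Definition cond_iid d1 (S1 : measurableType d1) (W : Type)
  (U1 U2 : T -> S1) (C : T -> W) : Prop :=
  cond_indep U1 U2 C /\
  forall (c : W) (A : set S1), measurable A ->
    pr [set w | U1 w \in A /\ C w = c] = pr [set w | U2 w \in A /\ C w = c].

End Defs.

(* f : R -> R is weakly kappa-bi-Lipschitz on domain D, with at most N pieces:
   f is kappa-Lipschitz on D and D decomposes into (at most) N pairwise disjoint
   pieces on each of which f is injective with kappa-Lipschitz inverse. *)
Definition weakly_biLipschitz (R : realType) (N : nat) (kappa : R) (D : set R)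
  (f : R -> R) : Prop :=
  (forall x y, D x -> D y -> `|f x - f y| <= kappa * `|x - y|) /\
  exists Pc : 'I_N -> set R,
    D = \bigcup_(i in [set: 'I_N]) Pc i /\
    trivIset [set: 'I_N] Pc /\
    forall i x y, Pc i x -> Pc i y -> `|x - y| <= kappa * `|f x - f y|.

(* Main.v *)
(* Draw w1, w2, w3 with w1 distributed according to P, w2 according to P given
   D_n Y(w2) = D_n Y(w1), and w3 according to P given D_n X(w3) = D_n X(w1), independently,
   and put (X', Y') = (X, Y)(w1), X'' = X(w2), Y'' = Y(w3). After replacing points by
   representatives of their grid cells, (X'', Y'), (X', Y') and (X', Y'') have the law of
   the discretized (X, Y), and
     f(X'') + g(Y'') = (f(X'') + g(Y')) - (f(X') + g(Y')) + (f(X') + g(Y'')).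
   The three sums on the right together with (X'', Y'') determine the whole quadruple up
   to boundedly many choices, and the quadruple has entropy 3H(X,Y) - H(X) - H(Y); a
   submodularity argument, run through Gibbs' inequality with weights that absorb the
   rounding errors, bounds H(f(X'') + g(Y'') | X', Y') by
   3H(f(X) + g(Y)) + 2H(X) + 2H(Y) - 3H(X,Y) + O(log kappa). *)
Require Import Defs.
From HB Require Import structures.
From mathcomp Require Import all_boot all_order all_algebra.
From mathcomp Require Import finmap.
From mathcomp Require Import all_classical all_reals all_analysis.
From mathcomp Require Import measurable_realfun.
From mathcomp Require Import ring lra zify.
Import Order.TTheory GRing.Theory Num.Theory.
Import numFieldNormedType.Exports.
Local Open Scope classical_set_scope.
Local Open Scope ring_scope.
Set Implicit Arguments.
Unset Strict Implicit.
Unset Printing Implicit Defensive.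

(** * Finite entropy *)

Section Log2.
Context {R : realType}.
Implicit Types x y : R.

Lemma ln2_gt0 : 0 < ln (2 : R).
Proof. by rewrite ln_gt0 ?ltr1n. Qed.

Lemma log2M x y : 0 < x -> 0 < y -> log2 (x * y) = log2 x + log2 y.
Proof. by move=> x0 y0; rewrite /log2 lnM ?posrE// mulrDl. Qed.

Lemma log2V x : 0 < x -> log2 x^-1 = - log2 x.
Proof. by move=> x0; rewrite /log2 lnV ?posrE// mulNr. Qed.

Lemma log2_div x y : 0 < x -> 0 < y -> log2 (x / y) = log2 x - log2 y.
Proof. by move=> x0 y0; rewrite log2M ?invr_gt0// log2V. Qed.

Lemma log2X x n : 0 < x -> log2 (x ^+ n) = n%:R * log2 x.
Proof. by move=> x0; rewrite /log2 lnXn// mulr_natl mulrnAl. Qed.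

Lemma ler_log2 x y : 0 < x -> x <= y -> log2 x <= log2 y.
Proof.
move=> x0 xy; rewrite ler_pM2r ?invr_gt0 ?ln2_gt0//.
by rewrite ler_ln ?posrE// (lt_le_trans x0).
Qed.

Lemma log2_ge0 x : 1 <= x -> 0 <= log2 x.
Proof. by move=> x1; rewrite divr_ge0 ?ln_ge0 ?ler1n. Qed.

Lemma log2_le0 x : x <= 1 -> log2 x <= 0.
Proof. by move=> x1; rewrite pmulr_lle0 ?invr_gt0 ?ln2_gt0// ln_le0. Qed.

(** Where [p i > 0], [ln x <= x - 1] at [x = q i / p i] bounds the term by [q i - p i]; where
    [p i = 0] the term vanishes and [q i >= 0]. A sub-probability [q] suffices, which allows
    unnormalized weights. *)
Lemma gibbs (I : finType) (p q : I -> R) :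
  (forall i, 0 <= p i) -> (forall i, 0 <= q i) ->
  \sum_i p i = 1 -> \sum_i q i <= 1 -> (forall i, 0 < p i -> 0 < q i) ->
  \sum_i p i * - log2 (p i) <= \sum_i p i * - log2 (q i).
Proof.
move=> p0 q0 p1 q1 pq; rewrite -subr_ge0 -sumrB.
suff: \sum_i p i * (ln (q i) - ln (p i)) <= 0.
  move=> h; rewrite (eq_bigr (fun i => - (p i * (ln (q i) - ln (p i)) / ln 2)));
    last by move=> i _; rewrite /log2; ring.
  by rewrite sumrN oppr_ge0 -mulr_suml pmulr_lle0 ?invr_gt0 ?ln2_gt0.
apply: (@le_trans _ _ (\sum_i (q i - p i))); last by rewrite sumrB p1 subr_le0.
apply: ler_sum => i _; have := p0 i; rewrite le_eqVlt => /predU1P[<-|pi0].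
  by rewrite mul0r subr0.
rewrite -ln_div ?posrE ?pq//.
have qp : 0 < q i / p i by rewrite divr_gt0 ?pq.
have := @le_ln1Dx _ (q i / p i - 1); rewrite addrCA subrr addr0 => h.
rewrite -(ler_pM2l pi0) in h.
have -> : q i - p i = p i * (q i / p i - 1) by field; rewrite gt_eqF.
by apply: h; rewrite ltrBrDr addNr.
Qed.

End Log2.

Lemma fsbig_finType (V : nmodType) (I : finType) (F : I -> V) :
  \sum_(i \in [set: I]) F i = \sum_i F i.
Proof.
rewrite (fsbigE (index_enum I))//= ?index_enum_uniq//.
  by rewrite big_mkcond; apply: eq_bigr => i _; rewrite in_setT.
by move=> i _; rewrite mem_index_enum.
Qed.

(** Bridge from the extended sums in the definition of entropy, taken over all values, to finite
    sums over an index type of attained values. *)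
Lemma esum_finite_range {R : realType} (I : finType) (V : choiceType) (e : I -> V)
    (a : V -> \bar R) : injective e -> (forall i, 0 <= a (e i))%E ->
    (forall v, ~ range e v -> a v = 0%E) ->
  (\esum_(v in [set: V]) a v = \sum_i a (e i))%E.
Proof.
move=> injE a0 ar; transitivity (\esum_(v in range e) a v)%E.
  rewrite [RHS]esum_mkcond; apply: eq_esum => v _.
  by case: ifPn => // /negP; rewrite inE => /ar ->.
rewrite (esum_image _ e); last by move=> i j _ _; exact: injE.
by rewrite esum_fset ?fsbig_finType//; exact: finite_finset.
Qed.

(** * Random variables with finitely many values, and their entropies *)

Section FiniteRandomVariables.
Context {R : realType} d {T : measurableType d} (P : probability T R).
Implicit Types A B : set T.

(** Measurability is stated on level sets so that the index type needs no sigma-algebra; finiteness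
    enters through [I : finType] where it is used. *)
Definition finite_rv (I : Type) (X : T -> I) :=
  forall i, measurable [set w | X w = i].

Definition pmf (I : Type) (X : T -> I) (i : I) : R := pr P [set w | X w = i].

Lemma pr_ge0 A : 0 <= pr P A.
Proof. exact: fine_ge0. Qed.

Lemma pr0 : pr P set0 = 0.
Proof. by rewrite /pr measure0. Qed.

Lemma prT : pr P setT = 1.
Proof. by rewrite /pr probability_setT. Qed.

Lemma prE A : measurable A -> P A = (pr P A)%:E.
Proof. by move=> mA; rewrite /pr fineK// fin_num_measure. Qed.

Lemma pr_le A B : measurable A -> measurable B -> A `<=` B -> pr P A <= pr P B.
Proof. by move=> mA mB AB; rewrite -lee_fin -!prE// le_measure ?inE. Qed.

Lemma pr_le1 A : measurable A -> pr P A <= 1.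
Proof. by move=> mA; rewrite -prT pr_le. Qed.

Lemma finite_rv_set (I : finType) (X : T -> I) (S : set I) :
  finite_rv X -> measurable [set w | S (X w)].
Proof.
move=> mX; rewrite (_ : mkset _ = \bigcup_(i in S) [set w | X w = i]).
  by apply: fin_bigcup_measurable => //; exact: finite_finset.
by apply/seteqP; split=> [w Sw|w [i Si /= ->]]//; exists (X w).
Qed.

Lemma finite_rv_comp (I : finType) (J : Type) (h : I -> J) (X : T -> I) :
  finite_rv X -> finite_rv (h \o X).
Proof. by move=> mX j; exact: (finite_rv_set [set i | h i = j]). Qed.

Lemma finite_rv_pair (I J : Type) (X : T -> I) (Y : T -> J) :
  finite_rv X -> finite_rv Y -> finite_rv (fun w => (X w, Y w)).
Proof.
move=> mX mY [i j]; rewrite (_ : mkset _ = [set w | X w = i] `&` [set w | Y w = j]).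
  exact: measurableI.
by apply/seteqP; split=> w /= [-> ->].
Qed.

Lemma pr_split (I : finType) (X : T -> I) A : finite_rv X -> measurable A ->
  pr P A = \sum_i pr P (A `&` [set w | X w = i]).
Proof.
move=> mX mA; have mAX i : measurable (A `&` [set w | X w = i]) by exact: measurableI.
apply: EFin_inj; rewrite -prE// -sumEFin.
rewrite {1}(_ : A = \bigcup_(i in [set: I]) (A `&` [set w | X w = i])); last first.
  by apply/seteqP; split=> [w Aw|w [i _ []]]//; exists (X w).
rewrite measure_fin_bigcup; last by move=> i _.
- by rewrite fsbig_finType; apply: eq_bigr => i _; exact: prE.
- exact: (@finite_finset I).
- apply/trivIsetP => i j _ _ /eqP ij; apply/seteqP; split=> w //=.
  by move=> [[_ Xi] [_ Xj]]; apply: ij; rewrite -Xi -Xj.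
Qed.

Lemma pmf_ge0 (I : Type) (X : T -> I) i : 0 <= pmf X i.
Proof. exact: pr_ge0. Qed.

Lemma pmf_le1 (I : Type) (X : T -> I) i : finite_rv X -> pmf X i <= 1.
Proof. by move=> mX; exact: pr_le1. Qed.

Lemma sum_pmf (I : finType) (X : T -> I) : finite_rv X -> \sum_i pmf X i = 1.
Proof.
move=> mX; rewrite -prT (pr_split mX measurableT).
by apply: eq_bigr => i _; rewrite setTI.
Qed.

(** Change of variables for expectations, by grouping the sum along the fibres of [h]. It moves
    every later expectation between a joint law and its marginals. *)
Lemma expect_comp (I J : finType) (X : T -> I) (h : I -> J) (phi : J -> R) :
  finite_rv X -> \sum_i pmf X i * phi (h i) = \sum_j pmf (h \o X) j * phi j.
Proof.
move=> mX; rewrite (partition_big h xpredT)//=; apply: eq_bigr => j _.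
rewrite (eq_bigr (fun i => pmf X i * phi j)); last by move=> i /eqP ->.
rewrite -mulr_suml; congr (_ * _).
rewrite /pmf [RHS](pr_split mX); last exact: finite_rv_comp.
rewrite big_mkcond; apply: eq_bigr => i _; case: eqP => hij.
  congr (pr P _); apply/seteqP; split=> w /=; last by case.
  by move=> Xw; rewrite Xw.
rewrite -[LHS]pr0; congr (pr P _); apply/seteqP; split=> w //= [+ Xw].
by rewrite Xw.
Qed.

Lemma pmf_comp_gt0 (I : finType) (J : Type) (X : T -> I) (h : I -> J) i :
  finite_rv X -> 0 < pmf X i -> 0 < pmf (h \o X) (h i).
Proof.
move=> mX /lt_le_trans; apply; apply: pr_le; [exact: mX|exact: finite_rv_comp|].
by move=> w /= ->.
Qed.

Lemma pmf_gt0_ex (I : Type) (X : T -> I) i : 0 < pmf X i -> exists w, X w = i.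
Proof.
move=> Xi; apply: contrapT => nX; move: Xi; rewrite /pmf (_ : mkset _ = set0).
  by rewrite pr0 ltxx.
by apply/seteqP; split=> w //= Xw; apply: nX; exists w.
Qed.

(** Otherwise every term of the decomposition along [Y] would vanish. This lifts an atom to a finer
    joint law. *)
Lemma pmf_pair_gt0 (I : Type) (J : finType) (X : T -> I) (Y : T -> J) i :
  finite_rv X -> finite_rv Y -> 0 < pmf X i ->
  exists j, 0 < pmf (fun w => (X w, Y w)) (i, j).
Proof.
move=> mX mY; rewrite /pmf (pr_split mY)//; apply: contraPP => /forallNP nXY.
apply/negP; rewrite -leNgt big1// => j _; apply/eqP; rewrite eq_le pr_ge0 andbT.
rewrite leNgt; apply/negP => XYj; apply: (nXY j).
rewrite /pmf (_ : mkset _ = [set w | X w = i] `&` [set w | Y w = j])//.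
by apply/seteqP; split=> w /= [-> ->].
Qed.

Definition ent (I : finType) (X : T -> I) : R := \sum_i pmf X i * - log2 (pmf X i).

Lemma entropyE (I : finType) (V : choiceType) (X : T -> I) (e : I -> V) :
  finite_rv X -> injective e -> entropy P (e \o X) = (ent X)%:E.
Proof.
move=> mX injE; have pmfE i : pr P [set w | (e \o X) w = e i] = pmf X i.
  by congr (pr P _); apply/seteqP; split=> w /= => [/injE|->].
rewrite /entropy (@esum_finite_range _ _ _ e)//.
- by rewrite sumEFin; congr (_%:E); apply: eq_bigr => i _; rewrite pmfE mulNr mulrN.
- move=> i; rewrite lee_fin pmfE mulNr -mulrN mulr_ge0 ?pmf_ge0// oppr_ge0.
  by rewrite log2_le0// pmf_le1.
- move=> v ev; rewrite (_ : mkset _ = set0) ?pr0 ?oppr0 ?mul0r//.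
  by apply/seteqP; split=> w //= Xw; apply: ev; exists (X w).
Qed.

(** The weight [P(C = c)] cancels the denominator of the conditional probability in front of the
    logarithm, leaving a single expectation over the joint law. *)
Lemma cond_entropyE (I J : finType) (V W : choiceType) (X : T -> I) (C : T -> J)
    (e : I -> V) (h : J -> W) :
  finite_rv X -> finite_rv C -> injective e -> injective h ->
  cond_entropy P (e \o X) (h \o C) =
  (\sum_u pmf (fun w => (X w, C w)) u *
     - log2 (pmf (fun w => (X w, C w)) u / pmf C u.2))%:E.
Proof.
move=> mX mC injE injh; set XC := fun w => (X w, C w).
have mXC : finite_rv XC by exact: finite_rv_pair.
have pmfC j : pr P [set w | (h \o C) w = h j] = pmf C j.
  by congr (pr P _); apply/seteqP; split=> w /= => [/injh|->].
have pmfXC i j : pr P [set w | (e \o X) w = e i /\ (h \o C) w = h j] = pmf XC (i, j).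
  congr (pr P _); apply/seteqP; split=> w /=; last by case=> -> ->.
  by case=> /injE + /injh; rewrite /XC => -> ->.
have q_ge0 i j : 0 <= pmf XC (i, j) / pmf C j by rewrite divr_ge0 ?pmf_ge0.
have q_le1 i j : pmf XC (i, j) / pmf C j <= 1.
  have [->|Cj] := eqVneq (pmf C j) 0; first by rewrite invr0 mulr0.
  rewrite ler_pdivrMr ?lt_neqAle 1?eq_sym ?Cj ?pmf_ge0// mul1r.
  by apply: pr_le => // w [].
pose G j := \sum_i (- (pmf XC (i, j) / pmf C j) * log2 (pmf XC (i, j) / pmf C j)).
have G_ge0 j : 0 <= G j.
  by apply: sumr_ge0 => i _; rewrite mulNr -mulrN mulr_ge0// oppr_ge0 log2_le0.
have givenE j : entropy_given P (e \o X) (h \o C) (h j) = (G j)%:E.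
  rewrite /entropy_given (@esum_finite_range _ _ _ e)//.
  - by rewrite sumEFin; congr (_%:E); apply: eq_bigr => i _; rewrite pmfXC pmfC.
  - by move=> i; rewrite /= pmfXC pmfC lee_fin mulNr -mulrN mulr_ge0// oppr_ge0 log2_le0.
  - move=> v ev; rewrite (_ : mkset _ = set0) ?pr0 ?mul0r ?oppr0 ?mul0r//.
    by apply/seteqP; split=> w //= [Xw _]; apply: ev; exists (X w).
rewrite /cond_entropy (@esum_finite_range _ _ _ h)//.
- rewrite (eq_bigr (fun j => (pmf C j * G j)%:E)); last first.
    by move=> j _; rewrite givenE pmfC.
  rewrite sumEFin; congr (_%:E); under eq_bigr do rewrite mulr_sumr.
  rewrite exchange_big pair_big/=; apply: eq_bigr => -[i j] _ /=.
  (* A null value of [C] contributes zero on both sides, since the joint mass is dominated by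
     [pmf C j]. *)
  have [C0|C0] := eqVneq (pmf C j) 0.
    suff -> : pmf XC (i, j) = 0 by rewrite !mul0r oppr0 mul0r mulr0.
    apply/eqP; rewrite eq_le pmf_ge0 andbT -C0.
    by apply: pr_le => // w [].
  by set l := log2 _; field.
- by move=> j; rewrite givenE pmfC mule_ge0// lee_fin// pmf_ge0.
- move=> v hv; rewrite (_ : mkset _ = set0) ?pr0 ?mul0e//.
  by apply/seteqP; split=> w //= Xw; apply: hv; exists (C w).
Qed.

Lemma ent_swap (I J : finType) (X : T -> I) (Y : T -> J) :
  ent (fun w => (Y w, X w)) = ent (fun w => (X w, Y w)).
Proof.
rewrite /ent (reindex (fun u : I * J => (u.2, u.1)))/=; last first.
  by exists (fun u => (u.2, u.1)) => -[].
apply: eq_bigr => -[i j] _ /=.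
suff -> : pmf (fun w => (Y w, X w)) (j, i) = pmf (fun w => (X w, Y w)) (i, j) by [].
by congr (pr P _); apply/seteqP; split=> w /= [-> ->].
Qed.

(* The hypothesis says that X and C are conditionally independent given h(C), and the
   conclusion that H(X | C) = H(X | h(C)). *)
Lemma markov_cond_entropy (I K L : finType) (X : T -> I) (C : T -> K) (h : K -> L) :
  finite_rv X -> finite_rv C ->
  (forall i k, pmf (fun w => (X w, C w)) (i, k) =
     pmf C k * (pmf (fun w => (X w, h (C w))) (i, h k) / pmf (h \o C) (h k))) ->
  \sum_u pmf (fun w => (X w, C w)) u * - log2 (pmf (fun w => (X w, C w)) u / pmf C u.2) =
  ent (fun w => (X w, h (C w))) - ent (h \o C).
Proof.
move=> mX mC ind; have mXC := finite_rv_pair mX mC.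
have mXh : finite_rv (fun w => (X w, h (C w))).
  exact: finite_rv_pair mX (finite_rv_comp h mC).
pose phi u := - log2 (pmf (fun w => (X w, h (C w))) u).
pose psi l := - log2 (pmf (h \o C) l).
rewrite (eq_bigr (fun u => pmf (fun w => (X w, C w)) u * phi (u.1, h u.2) -
    pmf (fun w => (X w, C w)) u * psi (h u.2))); last first.
  move=> [i k] _ /=; have := pmf_ge0 (fun w => (X w, C w)) (i, k).
  rewrite le_eqVlt => /predU1P[<-|ik]; first by rewrite !mul0r subr0.
  have Ck : 0 < pmf C k := pmf_comp_gt0 snd mXC ik.
  have hk : 0 < pmf (h \o C) (h k) := pmf_comp_gt0 h mC Ck.
  have Xhk : 0 < pmf (fun w => (X w, h (C w))) (i, h k).
    exact: (pmf_comp_gt0 (fun u => (u.1, h u.2)) mXC ik).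
  (* Only the occurrence inside the logarithm is rewritten: the ratio becomes the conditional
     probability given [h k], whose logarithm splits. *)
  rewrite {2}ind mulrAC divff ?gt_eqF// mul1r log2_div// /phi /psi; ring.
rewrite sumrB; congr (_ - _).
  exact: (expect_comp (fun u => (u.1, h u.2)) phi mXC).
exact: (expect_comp (fun u => h u.2) psi mXC).
Qed.

End FiniteRandomVariables.

(** * Couplings over a common finite value *)

Lemma measurable_preimage d1 d2 (T1 : measurableType d1) (T2 : measurableType d2)
    (U : T1 -> T2) (A : set T2) :
  measurable_fun setT U -> measurable A -> measurable [set t | U t \in A].
Proof.
move=> mU mA; rewrite (_ : mkset _ = setT `&` U @^-1` A); first exact: mU.
by rewrite setTI; apply/seteqP; split=> t /=; rewrite inE.
Qed.

Lemma finite_rv_measurable_comp d1 d2 (T1 : measurableType d1) (T2 : measurableType d2)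
    (K : Type) (C : T2 -> K) (h : T1 -> T2) :
  measurable_fun setT h -> finite_rv C -> finite_rv (C \o h).
Proof. by move=> mh mC k; rewrite -[mkset _]setTI; exact: mh measurableT _ (mC k). Qed.

(** Conditional independence quantifies over all values [c], attained or not; this dichotomy reduces
    it to finite indices. *)
Lemma inj_comp_level (T I W : Type) (C : T -> I) (e : I -> W) (c : W) :
  injective e ->
  (forall t, (e \o C) t <> c) \/ exists i, forall t, ((e \o C) t = c) = (C t = i).
Proof.
move=> injE; have [[i _ <-]|ec] := pselect (range e c).
  by right; exists i => t; apply/propext; split=> [/injE|/= ->].
by left=> t Ct; apply: ec; exists (C t).
Qed.

Lemma mnormalize_id {R : realType} d (T : measurableType d) (mu : measure T R)
    (Q : probability T R) :
  mu setT = 1%E -> mnormalize mu Q =1 mu.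
Proof. by move=> muT U; rewrite /mnormalize muT onee_eq0/= invr1 mule1. Qed.

Section Coupling.
Context {R : realType} d1 d2 {T1 : measurableType d1} {T2 : measurableType d2}.
Variables (P1 : probability T1 R) (P2 : probability T2 R).
Variables (I : finType) (C1 : T1 -> I) (C2 : T2 -> I).
Hypotheses (mC1 : finite_rv C1) (mC2 : finite_rv C2).
Hypothesis lawC : pmf P1 C1 =1 pmf P2 C2.

(* The two coordinates are independent given the common value of C1 and C2; a null
   value i contributes 0, as x / 0 = 0. *)
Definition is_coupling (P : probability (T1 * T2)%type R) :=
  forall (G : set T1) (E : set T2), measurable G -> measurable E ->
    pr P (G `*` E) = \sum_i
      pr P1 (G `&` [set t | C1 t = i]) * pr P2 (E `&` [set t | C2 t = i]) / pmf P2 C2 i.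

(** The witness is a sum over [i] of product measures restricted to the rectangle [C1 = i], [C2 = i]
    and divided by the probability of [C2 = i]. Equality of the laws of [C1] and [C2] makes its
    total mass one. *)
Lemma coupling_exists : exists P, is_coupling P.
Proof.
have mD i : measurable ([set t | C1 t = i] `*` [set t | C2 t = i]).
  exact: measurableX.
have p0 i : 0 <= (pmf P2 C2 i)^-1 by rewrite invr_ge0 pmf_ge0.
pose m_ i : measure (T1 * T2)%type R :=
  mscale (NngNum (p0 i)) (mrestr (P1 \x P2)%E (mD i)).
pose mz : measure (T1 * T2)%type R := mzero.
pose m := msum (nth mz [seq m_ i | i <- index_enum I])
  (size [seq m_ i | i <- index_enum I]).
have mGE G E : measurable G -> measurable E -> m (G `*` E) = (\sum_i
    pr P1 (G `&` [set t | C1 t = i]) * pr P2 (E `&` [set t | C2 t = i]) / pmf P2 C2 i)%:E.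
  move=> mG mE; rewrite /m /msum.
  rewrite -(big_mkord xpredT (fun k => nth mz [seq m_ i | i <- index_enum I] k (G `*` E))).
  rewrite -(big_nth mz xpredT (fun mu : measure (T1 * T2)%type R => mu (G `*` E))).
  rewrite big_map -sumEFin; apply: eq_bigr => i _.
  rewrite /m_ /= /mscale/= /mrestr -setXI product_measure1E; [|exact: measurableI..].
  rewrite mulrC !EFinM; congr (_ * (_ * _))%E; apply: prE; exact: measurableI.
have mT : m setT = 1%E.
  rewrite -setXTT mGE//; congr (_%:E); rewrite -(sum_pmf P2 mC2).
  apply: eq_bigr => i _; rewrite !setTI -!/(pmf _ _ _) lawC.
  have [->|Ci] := eqVneq (pmf P2 C2 i) 0; first by rewrite !mul0r.
  by rewrite mulfK.
(* Normalizing supplies the probability structure and changes no value, as the mass is already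
   one. *)
exists (mnormalize m (P1 \x P2)%E) => G E mG mE.
suff -> : pr (mnormalize m (P1 \x P2)%E) (G `*` E) = fine (m (G `*` E)) by rewrite mGE.
by congr fine; exact: mnormalize_id mT _.
Qed.

Variables (P : probability (T1 * T2)%type R) (couplP : is_coupling P).

Lemma coupling_fst G : measurable G -> pr P (G `*` setT) = pr P1 G.
Proof.
move=> mG; rewrite couplP// (pr_split P1 mC1 mG); apply: eq_bigr => i _.
rewrite setTI -/(pmf _ _ _).
(* A null level of [C2] is a null level of [C1], so the part of [G] in it has probability zero
   too. *)
have [Ci|Ci] := eqVneq (pmf P2 C2 i) 0; last by rewrite mulfK.
rewrite Ci mulr0 mul0r; apply/esym/eqP; rewrite eq_le pr_ge0 andbT -Ci -lawC.
by apply: pr_le; [exact: measurableI|exact: mC1|exact: subIsetr].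
Qed.

(** Only the summand [i] survives once [G] lies inside one level of [C1]. *)
Lemma coupling_slice G E i : measurable G -> measurable E ->
  G `<=` [set t | C1 t = i] ->
  pr P (G `*` E) = pr P1 G * pr P2 (E `&` [set t | C2 t = i]) / pmf P2 C2 i.
Proof.
move=> mG mE Gi; rewrite couplP// (bigD1 i)//= (setIidl Gi) big1 ?addr0// => j ji.
rewrite (_ : G `&` _ = set0) ?pr0 ?mul0r//.
by apply/seteqP; split=> t //= [/Gi /= Ci Cj]; move: ji; rewrite -Ci -Cj eqxx.
Qed.

(** Since both coordinates share the common value, [C1] of the first can stand for [C2] of the
    second: jointly with it, the second coordinate keeps its law under [P2]. *)
Lemma coupling_law E i : measurable E ->
  pr P ([set t | C1 t = i] `*` E) = pr P2 (E `&` [set t | C2 t = i]).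
Proof.
move=> mE; rewrite (coupling_slice (i := i))// -/(pmf _ _ _) lawC.
have [Ci|Ci] := eqVneq (pmf P2 C2 i) 0; last by rewrite mulrAC mulfV// mul1r.
rewrite Ci mul0r mul0r; apply/esym/eqP; rewrite eq_le pr_ge0 andbT -Ci.
by apply: pr_le; [exact: measurableI|exact: mC2|exact: subIsetr].
Qed.

Section Independence.
Context d3 d4 {S1 : measurableType d3} {S2 : measurableType d4}.
Variables (U1 : T1 -> S1) (U2 : T2 -> S2).
Hypotheses (mU1 : measurable_fun setT U1) (mU2 : measurable_fun setT U2).

(** All four events are rectangles, so the slice formula and the two marginals give the product
    rule. The map [e] lets the conditioning variable be a grid point instead of its index. *)
Lemma coupling_cond_indep (W : Type) (e : I -> W) : injective e ->
  cond_indep P (U1 \o fst) (U2 \o snd) (e \o C1 \o fst).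
Proof.
move=> injE c A1 A2 mA1 mA2.
have mV1 := measurable_preimage mU1 mA1; have mV2 := measurable_preimage mU2 mA2.
case: (inj_comp_level C1 c injE) => [nc|[i ci]].
  have pr_c0 S : S `<=` [set w | (e \o C1 \o fst) w = c] -> pr P S = 0.
    move=> Sc; rewrite (_ : S = set0) ?pr0//.
    by apply/seteqP; split=> w // /Sc /nc.
  rewrite [X in _ * X = _]pr_c0// [X in _ = X * _]pr_c0 ?mulr0 ?mul0r//.
  by move=> w [].
have mi := mC1 i.
rewrite [X in pr P X * _ = _](_ : _ =
    ([set t | U1 t \in A1] `&` [set t | C1 t = i]) `*` [set t | U2 t \in A2]); last first.
  by apply/seteqP; split=> w /=; rewrite ci; tauto.
rewrite [X in _ * pr P X = _](_ : _ = [set t | C1 t = i] `*` setT); last first.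
  by apply/seteqP; split=> w /=; rewrite ci; tauto.
rewrite [X in _ = pr P X * _](_ : _ =
    ([set t | U1 t \in A1] `&` [set t | C1 t = i]) `*` setT); last first.
  by apply/seteqP; split=> w /=; rewrite ci; tauto.
rewrite [X in _ = _ * pr P X](_ : _ =
    [set t | C1 t = i] `*` [set t | U2 t \in A2]); last first.
  by apply/seteqP; split=> w /=; rewrite ci; tauto.
have mVi := measurableI _ _ mV1 mi.
rewrite (coupling_slice (i := i))// !coupling_fst// coupling_law// -/(pmf _ _ _) lawC.
have [Ci|Ci] := eqVneq (pmf P2 C2 i) 0; last by rewrite mulfVK.
rewrite Ci mulr0; apply/esym/eqP; rewrite mulf_eq0; apply/orP; left.
rewrite eq_le pr_ge0 andbT -Ci -lawC.
by apply: pr_le; [exact: measurableI|exact: mC1|exact: subIsetr].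
Qed.
End Independence.

Lemma coupling_cond_iid d3 (S : measurableType d3) (U1 : T1 -> S) (U2 : T2 -> S)
    (W : Type) (e : I -> W) :
  measurable_fun setT U1 -> measurable_fun setT U2 -> injective e ->
  (forall i A, measurable A -> pr P1 [set t | U1 t \in A /\ C1 t = i] =
                               pr P2 [set t | U2 t \in A /\ C2 t = i]) ->
  cond_iid P (U1 \o fst) (U2 \o snd) (e \o C1 \o fst).
Proof.
move=> mU1 mU2 injE lawU; split; first exact: coupling_cond_indep.
move=> c A mA.
have mV1 := measurable_preimage mU1 mA; have mV2 := measurable_preimage mU2 mA.
case: (inj_comp_level C1 c injE) => [nc|[i ci]].
  by congr (pr P _); apply/seteqP; split=> w [_ /nc].
have mi := mC1 i.
rewrite [X in pr P X = _](_ : _ =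
    ([set t | U1 t \in A] `&` [set t | C1 t = i]) `*` setT); last first.
  by apply/seteqP; split=> w /=; rewrite ci; tauto.
rewrite [X in _ = pr P X](_ : _ =
    [set t | C1 t = i] `*` [set t | U2 t \in A]); last first.
  by apply/seteqP; split=> w /=; rewrite ci; tauto.
have mVi := measurableI _ _ mV1 mi.
by rewrite coupling_fst// coupling_law//; exact: lawU.
Qed.

(** All events involved depend on the first coordinate only, whose marginal is [P1]; this carries a
    property of the inner coupling to the outer one. *)
Lemma cond_iid_fst d3 (S : measurableType d3) (U1 U2 : T1 -> S)
    (J W : Type) (C : T1 -> J) (e : J -> W) :
  measurable_fun setT U1 -> measurable_fun setT U2 -> finite_rv C -> injective e ->
  cond_iid P1 U1 U2 (e \o C) -> cond_iid P (U1 \o fst) (U2 \o fst) (e \o C \o fst).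
Proof.
move=> mU1 mU2 mC injE; have lift A : measurable A -> pr P [set w | A w.1] = pr P1 A.
  move=> mA; rewrite -coupling_fst//; congr (pr P _).
  by apply/seteqP; split=> w /=; tauto.
have mc c : measurable [set t | (e \o C) t = c].
  case: (inj_comp_level C c injE) => [nc|[i ci]].
    by rewrite (_ : mkset _ = set0)//; apply/seteqP; split=> t //= /nc.
  by rewrite (_ : mkset _ = [set t | C t = i])//; apply/seteqP; split=> t /=; rewrite ci.
move=> [ind law]; split=> [c A1 A2 mA1 mA2|c A mA].
- have mV1 := measurable_preimage mU1 mA1; have mV2 := measurable_preimage mU2 mA2.
  have := ind c A1 A2 mA1 mA2.
  rewrite -(lift [set t | U1 t \in A1 /\ U2 t \in A2 /\ (e \o C) t = c]); last first.
    exact: measurableI _ _ mV1 (measurableI _ _ mV2 (mc c)).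
  rewrite -(lift [set t | (e \o C) t = c])//.
  rewrite -(lift [set t | U1 t \in A1 /\ (e \o C) t = c]); last first.
    exact: measurableI _ _ mV1 (mc c).
  rewrite -(lift [set t | U2 t \in A2 /\ (e \o C) t = c])//.
  exact: measurableI _ _ mV2 (mc c).
- have mV1 := measurable_preimage mU1 mA; have mV2 := measurable_preimage mU2 mA.
  have := law c A mA.
  rewrite -(lift [set t | U1 t \in A /\ (e \o C) t = c]); last first.
    exact: measurableI _ _ mV1 (mc c).
  rewrite -(lift [set t | U2 t \in A /\ (e \o C) t = c])//.
  exact: measurableI _ _ mV2 (mc c).
Qed.

End Coupling.

(** * The entropy inequality *)

Section EntropyInequality.
Context {R : realType} d {T : measurableType d} (P : probability T R).
Context d' {T' : measurableType d'} (P' : probability T' R).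
Variables I J Z V : finType.
Variables (ix : T -> I) (iy : T -> J) (iz : T -> Z).
Variables (a2 a1 : T' -> I) (b1 b3 : T' -> J) (s : T' -> V).
Hypotheses (m_ix : finite_rv ix) (m_iy : finite_rv iy) (m_iz : finite_rv iz).
Hypotheses (m_a2 : finite_rv a2) (m_a1 : finite_rv a1) (m_b1 : finite_rv b1)
  (m_b3 : finite_rv b3) (m_s : finite_rv s).

Let ixy w := (ix w, iy w).
Let tot w := ((a2 w, b1 w), (a1 w, b3 w)).

Hypothesis law21 : pmf P' (fun w => (a2 w, b1 w)) =1 pmf P ixy.
Hypothesis law11 : pmf P' (fun w => (a1 w, b1 w)) =1 pmf P ixy.
Hypothesis law13 : pmf P' (fun w => (a1 w, b3 w)) =1 pmf P ixy.
(** The cell indices form a Markov chain in the order [a2], [b1], [a1], [b3]. *)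
Hypothesis law_tot : forall i j k l, pmf P' tot ((i, j), (k, l)) =
  pmf P ixy (i, j) * pmf P ixy (k, j) * pmf P ixy (k, l) /
  (pmf P iy j * pmf P ix k).

(** [F] and [G] stand for the rescaled values of [f] and [g] at cell representatives, [zv] and [sv]
    for the integer parts of the rescaled sums, [r] for the rounding error, [M] and [C] for
    multiplicities. *)
Variables (F : I -> R) (G : J -> R) (zv : Z -> R) (sv : V -> R) (r M C : R).
Hypothesis iz_near : forall w, `|zv (iz w) - (F (ix w) + G (iy w))| <= r.
Hypothesis s_near : forall w, `|sv (s w) - (F (a2 w) + G (b3 w))| <= r.
Hypothesis countF : forall t, \sum_i (`|F i - t| <= r)%R%:R <= M.
Hypothesis countG : forall t, \sum_j (`|G j - t| <= r)%R%:R <= M.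
Hypothesis count_sv : forall t, \sum_v (`|sv v - t| <= 4 * r)%R%:R <= C.
Hypotheses (M_gt0 : 0 < M) (C_gt0 : 0 < C).

(* mu u is the probability that the discretized sum lies within r of u, and Q smears the
   law of z1 - z2 + z3, for independent copies z1, z2, z3 of the discretized sum. *)
Let w := pmf P iz.
Let mu u := \sum_z w z * (`|zv z - u| <= r)%R%:R.
Let mu3 i j k l := mu (F i + G j) * mu (F k + G j) * mu (F k + G l).
Let N i l := \sum_j \sum_k mu3 i j k l.
Let Q v := C^-1 * \sum_(z : Z * Z * Z) w z.1.1 * w z.1.2 * w z.2 *
  (`|zv z.1.1 - zv z.1.2 + zv z.2 - sv v| <= 4 * r)%R%:R.

Let w_ge0 z : 0 <= w z. Proof. exact: pmf_ge0. Qed.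

Let m_ixy : finite_rv ixy. Proof. exact: finite_rv_pair. Qed.

Let m_tot : finite_rv tot.
Proof. by apply: finite_rv_pair; apply: finite_rv_pair. Qed.

Let mu_ge0 u : 0 <= mu u.
Proof. by apply: sumr_ge0 => z _; rewrite mulr_ge0. Qed.

Let mu3_ge0 i j k l : 0 <= mu3 i j k l.
Proof. by rewrite !mulr_ge0. Qed.

Let N_ge0 i l : 0 <= N i l.
Proof. by do 2![apply: sumr_ge0 => ? _]. Qed.

Let Q_ge0 v : 0 <= Q v.
Proof. by rewrite mulr_ge0 ?invr_ge0 ?(ltW C_gt0)// sumr_ge0// => z _; rewrite !mulr_ge0. Qed.

Let le_mu i j z : 0 < pmf P (fun t => (ixy t, iz t)) ((i, j), z) ->
  0 < w z <= mu (F i + G j).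
Proof.
move=> h; have mXZ := finite_rv_pair m_ixy m_iz.
rewrite (pmf_comp_gt0 snd mXZ h) /=.
have [t [<- <- <-]] := pmf_gt0_ex h.
rewrite /mu (bigD1 (iz t))//= iz_near mulr1 lerDl sumr_ge0// => y _.
by rewrite mulr_ge0.
Qed.

Let mu_gt0 i j : 0 < pmf P ixy (i, j) -> 0 < mu (F i + G j).
Proof.
by move=> /(pmf_pair_gt0 m_ixy m_iz)[z /le_mu /andP[]]; exact: lt_le_trans.
Qed.

(** Compare pointwise on the joint law with [iz]: the atom of the actual sum is one of those counted
    in [mu]. *)
Let mu_expect : \sum_u pmf P ixy u * - log2 (mu (F u.1 + G u.2)) <= ent P iz.
Proof.
have mXZ := finite_rv_pair m_ixy m_iz.
rewrite -(expect_comp P fst (fun u => - log2 (mu (F u.1 + G u.2))) mXZ).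
rewrite /ent -(expect_comp P snd (fun z => - log2 (pmf P iz z)) mXZ).
apply: ler_sum => -[[i j] z] _ /=.
have := pmf_ge0 P (fun t => (ixy t, iz t)) ((i, j), z).
rewrite le_eqVlt => /predU1P[<-|h]; first by rewrite !mul0r.
have /andP[wz wmu] := le_mu h.
by rewrite ler_wpM2l ?(ltW h)// lerN2 ler_log2.
Qed.

(** Positivity passes to all marginals, so that logarithms of products and quotients may be split on
    the support. *)
Let tot_gt0 i j k l : 0 < pmf P' tot ((i, j), (k, l)) ->
  [/\ 0 < pmf P ixy (i, j), 0 < pmf P ixy (k, j), 0 < pmf P ixy (k, l),
      0 < pmf P ix k & 0 < pmf P iy j] /\ (0 < pmf P ix i /\ 0 < pmf P iy l).
Proof.
move=> h.
have h21 : 0 < pmf P ixy (i, j) by rewrite -law21; exact: (pmf_comp_gt0 fst m_tot h).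
have h11 : 0 < pmf P ixy (k, j).
  rewrite -law11.
  exact: (pmf_comp_gt0 (fun u : I * J * (I * J) => (u.2.1, u.1.2)) m_tot h).
have h13 : 0 < pmf P ixy (k, l) by rewrite -law13; exact: (pmf_comp_gt0 snd m_tot h).
split; split=> //.
- exact: (pmf_comp_gt0 fst m_ixy h11).
- exact: (pmf_comp_gt0 snd m_ixy h11).
- exact: (pmf_comp_gt0 fst m_ixy h21).
- exact: (pmf_comp_gt0 snd m_ixy h13).
Qed.

Let N_gt0 i j k l : 0 < pmf P' tot ((i, j), (k, l)) -> 0 < mu3 i j k l <= N i l.
Proof.
move=> /tot_gt0[[h21 h11 h13 _ _] _].
rewrite !mulr_gt0 ?mu_gt0//= /N (bigD1 j)//= (bigD1 k)//= -addrA lerDl addr_ge0//.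
  by apply: sumr_ge0.
by do 2![apply: sumr_ge0 => ? _].
Qed.

Let mu3_expand u1 u2 u3 : mu u1 * mu u2 * mu u3 =
  \sum_(z : Z * Z * Z) w z.1.1 * w z.1.2 * w z.2 *
    ((`|zv z.1.1 - u1| <= r)%R%:R * (`|zv z.1.2 - u2| <= r)%R%:R *
     (`|zv z.2 - u3| <= r)%R%:R).
Proof.
rewrite /mu big_distrlr/= pair_big/= big_distrlr/= pair_big/=.
by apply: eq_bigr => -[[z1 z2] z3] _ /=; ring.
Qed.

(* F i + G l = (F i + G j) - (F k + G j) + (F k + G l), and given z1, z2, z3, i and l
   there are at most M choices for each of j and k. *)
Let N_leQ i l v : `|sv v - (F i + G l)| <= r -> N i l <= M ^+ 2 * C * Q v.
Proof.
move=> hv; rewrite /Q -mulrA mulVKf ?gt_eqF// mulr_sumr /N.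
under eq_bigr do under eq_bigr do rewrite /mu3 mu3_expand.
under eq_bigr do rewrite exchange_big/=.
rewrite exchange_big/=; apply: ler_sum => -[[z1 z2] z3] _ /=.
under eq_bigr do rewrite -mulr_sumr.
rewrite -mulr_sumr [leRHS]mulrCA ler_wpM2l ?mulr_ge0//.
set b := (`|zv z1 - zv z2 + _ - _| <= _).
apply: (@le_trans _ _ ((\sum_j (`|G j - (zv z1 - F i)| <= r)%R%:R) *
    (\sum_k (`|F k - (zv z3 - G l)| <= r)%R%:R) * b%:R)); last first.
  rewrite ler_wpM2r// expr2 ler_pM//; exact: sumr_ge0.
rewrite big_distrlr/= mulr_suml; apply: ler_sum => j _.
rewrite mulr_suml; apply: ler_sum => k _.
case: (boolP (`|zv z1 - _| <= r)) => [h1|_]; last by rewrite !mul0r !mulr_ge0.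
case: (boolP (`|zv z2 - _| <= r)) => [h2|_]; last by rewrite mulr0 mul0r !mulr_ge0.
case: (boolP (`|zv z3 - _| <= r)) => [h3|_]; last by rewrite mulr0 !mulr_ge0.
rewrite !ler_distl in hv h1 h2 h3.
move/andP: hv => [? ?]; move/andP: h1 => [? ?].
move/andP: h2 => [? ?]; move/andP: h3 => [? ?].
(* Four errors of at most [r] add up: one for each of the three sums and one from [hv]. *)
have -> : b by rewrite /b ler_distl; apply/andP; split; lra.
have -> : `|G j - (zv z1 - F i)| <= r by rewrite ler_distl; apply/andP; split; lra.
have -> : `|F k - (zv z3 - G l)| <= r by rewrite ler_distl; apply/andP; split; lra.
by rewrite !mulr1.
Qed.

(** Each triple of sums is within [4 * r] of at most [C] values [sv v], which the factor [C^-1]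
    offsets. *)
Let sum_Q : \sum_v Q v <= 1.
Proof.
rewrite -mulr_sumr exchange_big/= ler_pdivrMl// mulr1.
apply: (@le_trans _ _ (\sum_(z : Z * Z * Z) w z.1.1 * w z.1.2 * w z.2 * C)).
  apply: ler_sum => z _; rewrite -mulr_sumr ler_wpM2l ?mulr_ge0//.
  under eq_bigr do rewrite distrC.
  exact: count_sv.
rewrite -mulr_suml ger_pMl//.
have sw : \sum_z w z = 1 by exact: sum_pmf.
suff -> : \sum_(z : Z * Z * Z) w z.1.1 * w z.1.2 * w z.2 = 1 by [].
have -> : 1 = (\sum_z w z) * (\sum_z w z) * (\sum_z w z) by rewrite sw !mulr1.
by rewrite big_distrlr/= pair_big/= big_distrlr/= pair_big/=.
Qed.

(* Gibbs' inequality for the law of the quadruple against the weight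
   mu3 * px * py / N, whose total mass is at most 1 because N is the sum of mu3
   over the two middle coordinates. *)
Let expect_N : \sum_u pmf P' tot u * - log2 (N u.1.1 u.2.2) <=
  3 * ent P iz + 2 * ent P ix + 2 * ent P iy - 3 * ent P ixy.
Proof.
pose q (u : I * J * (I * J)) := mu3 u.1.1 u.1.2 u.2.1 u.2.2 *
  (pmf P ix u.1.1 * pmf P iy u.2.2) / N u.1.1 u.2.2.
have q_ge0 u : 0 <= q u by rewrite divr_ge0// !mulr_ge0// pmf_ge0.
have sum_q : \sum_u q u <= 1.
  rewrite -(pair_bigA _ (fun u v => q (u, v)))/=.
  rewrite -(pair_bigA _ (fun i j => \sum_v q ((i, j), v)))/=.
  under eq_bigr do under eq_bigr do rewrite -(pair_bigA _ (fun k l => q (_, (k, l))))/=.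
  have -> : 1 = \sum_i pmf P ix i * \sum_l pmf P iy l.
    by rewrite (sum_pmf P m_iy) -mulr_suml (sum_pmf P m_ix) mulr1.
  apply: ler_sum => i _; rewrite mulr_sumr.
  (* Reorder so that the middle coordinates [j] and [k] are summed innermost; they rebuild [N i l]
     and cancel the denominator. *)
  under eq_bigr do rewrite exchange_big/=.
  rewrite exchange_big/=; apply: ler_sum => l _; rewrite /q/=.
  under eq_bigr do under eq_bigr do rewrite -mulrA.
  under eq_bigr do rewrite -mulr_suml.
  rewrite -mulr_suml -/(N i l).
  have [->|N0] := eqVneq (N i l) 0; first by rewrite mul0r mulr_ge0 ?pmf_ge0.
  by rewrite mulrCA divff// mulr1.
have q_gt0 u : 0 < pmf P' tot u -> 0 < q u.
  case: u => -[i j] [k l] h; rewrite /q /=.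
  have /andP[m0 mN] := N_gt0 h.
  have [_ [? ?]] := tot_gt0 h.
  by apply: divr_gt0; [apply: mulr_gt0; [|exact: mulr_gt0]|exact: lt_le_trans m0 mN].
have := gibbs (pmf_ge0 P' tot) q_ge0 (sum_pmf P' m_tot) sum_q q_gt0.
pose f u := log2 (pmf P ixy u) - log2 (mu (F u.1 + G u.2)).
pose fx i := - log2 (pmf P ix i).
pose fy j := - log2 (pmf P iy j).
rewrite -subr_ge0 -sumrB.
(* Expand the logarithms: one [f] for each of the three edges of the chain, while the end marginals
   come from [q] and the middle ones from the denominator of [law_tot]. *)
rewrite (eq_bigr (fun u => pmf P' tot u * f u.1 + pmf P' tot u * f (u.2.1, u.1.2) +
   pmf P' tot u * f u.2 + pmf P' tot u * fx u.1.1 + pmf P' tot u * fx u.2.1 +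
   pmf P' tot u * fy u.1.2 + pmf P' tot u * fy u.2.2 -
   pmf P' tot u * - log2 (N u.1.1 u.2.2))); last first.
  move=> [[i j] [k l]] _.
  have := pmf_ge0 P' tot ((i, j), (k, l)).
  rewrite le_eqVlt => /predU1P[<-|h]; first by rewrite !mul0r; ring.
  have /andP[m0 mN] := N_gt0 h.
  have [[? ? ? ? ?] [? ?]] := tot_gt0 h.
  have N0 := lt_le_trans m0 mN.
  have [? ? ?] : [/\ 0 < mu (F i + G j), 0 < mu (F k + G j) & 0 < mu (F k + G l)].
    by split; exact: mu_gt0.
  rewrite /q /mu3 /f /fx /fy /= {3}law_tot.
  rewrite !log2_div ?log2M ?mulr_gt0//; ring.
rewrite sumrB !big_split/=.
have e21 : \sum_u pmf P' tot u * f u.1 = \sum_u pmf P ixy u * f u.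
  rewrite (expect_comp P' fst f m_tot).
  by apply: eq_bigr => u _; rewrite -law21.
have e11 : \sum_u pmf P' tot u * f (u.2.1, u.1.2) = \sum_u pmf P ixy u * f u.
  rewrite (expect_comp P' (fun u : I * J * (I * J) => (u.2.1, u.1.2)) f m_tot).
  by apply: eq_bigr => u _; rewrite -law11.
have e13 : \sum_u pmf P' tot u * f u.2 = \sum_u pmf P ixy u * f u.
  rewrite (expect_comp P' snd f m_tot).
  by apply: eq_bigr => u _; rewrite -law13.
have ex : \sum_u pmf P ixy u * fx u.1 = ent P ix.
  by rewrite (expect_comp P fst fx m_ixy).
have ey : \sum_u pmf P ixy u * fy u.2 = ent P iy.
  by rewrite (expect_comp P snd fy m_ixy).
have x2 : \sum_u pmf P' tot u * fx u.1.1 = ent P ix.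
  rewrite (expect_comp P' fst (fun u => fx u.1) m_tot) -ex.
  by apply: eq_bigr => u _; rewrite -law21.
have x1 : \sum_u pmf P' tot u * fx u.2.1 = ent P ix.
  rewrite (expect_comp P' snd (fun u => fx u.1) m_tot) -ex.
  by apply: eq_bigr => u _; rewrite -law13.
have y1 : \sum_u pmf P' tot u * fy u.1.2 = ent P iy.
  rewrite (expect_comp P' fst (fun u => fy u.2) m_tot) -ey.
  by apply: eq_bigr => u _; rewrite -law21.
have y3 : \sum_u pmf P' tot u * fy u.2.2 = ent P iy.
  rewrite (expect_comp P' snd (fun u => fy u.2) m_tot) -ey.
  by apply: eq_bigr => u _; rewrite -law13.
have ef : \sum_u pmf P ixy u * f u <= ent P iz - ent P ixy.
  rewrite /ent -[X in _ <= _ - X]/(\sum_u pmf P ixy u * - log2 (pmf P ixy u)).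
  rewrite (eq_bigr (fun u => pmf P ixy u * - log2 (mu (F u.1 + G u.2)) -
    pmf P ixy u * - log2 (pmf P ixy u))); last by move=> u _; rewrite /f; ring.
  by rewrite sumrB lerD2r; exact: mu_expect.
rewrite e21 e11 e13 x2 x1 y1 y3; lra.
Qed.

Let sab t := (s t, (a1 t, b1 t)).

(** Gibbs' inequality against the product of the law of [(a1, b1)] with [Q] bounds the conditional
    entropy by the mean of [- log2 (Q s)]. The bound of [N] by [Q] costs [log2 (M ^+ 2 * C)], and
    [expect_N] finishes. *)
Lemma cond_entropy_sum_le :
  \sum_u pmf P' sab u * - log2 (pmf P' sab u / pmf P' (fun t => (a1 t, b1 t)) u.2) <=
  3 * ent P iz + 2 * ent P ix + 2 * ent P iy - 3 * ent P ixy + log2 (M ^+ 2 * C).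
Proof.
have m_ab : finite_rv (fun t => (a1 t, b1 t)) by exact: finite_rv_pair.
have m_sab : finite_rv sab by exact: finite_rv_pair.
have m_st : finite_rv (fun t => (s t, tot t)) by exact: finite_rv_pair.
have NQ v u : 0 < pmf P' (fun t => (s t, tot t)) (v, u) ->
    0 < N u.1.1 u.2.2 <= M ^+ 2 * C * Q v.
  move=> h; have h' := pmf_comp_gt0 snd m_st h.
  case: u h h' => -[i j] [k l] h h' /=.
  have /andP[m0 mN] := N_gt0 h'; rewrite (lt_le_trans m0 mN)/=.
  have [t [<- <- _ _ <-]] := pmf_gt0_ex h.
  exact: N_leQ.
pose pab := pmf P' (fun t => (a1 t, b1 t)).
pose q u := pab u.2 * Q u.1.
have MC : 0 < M ^+ 2 * C by rewrite mulr_gt0// exprn_gt0.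
have Q_gt0 v u : 0 < pmf P' (fun t => (s t, tot t)) (v, u) -> 0 < Q v.
  by move=> /NQ /andP[N0 /(lt_le_trans N0)]; rewrite pmulr_rgt0.
have sab_gt0 u : 0 < pmf P' sab u -> 0 < pab u.2 /\ 0 < Q u.1.
  move=> h; split; first exact: (pmf_comp_gt0 snd m_sab h).
  have [v hv] := pmf_pair_gt0 m_sab m_tot h.
  have m_sabt := finite_rv_pair m_sab m_tot.
  have := pmf_comp_gt0 (fun x : V * (I * J) * (I * J * (I * J)) => (x.1.1, x.2)) m_sabt hv.
  exact: Q_gt0.
have q_ge0 u : 0 <= q u by rewrite mulr_ge0// pmf_ge0.
have sum_q : \sum_u q u <= 1.
  rewrite -(pair_bigA _ (fun v u => q (v, u)))/= /q/=.
  under eq_bigr do rewrite -mulr_suml.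
  by rewrite -mulr_sumr (sum_pmf P' m_ab) mul1r.
have q_gt0 u : 0 < pmf P' sab u -> 0 < q u.
  by move=> /sab_gt0[? ?]; rewrite mulr_gt0.
have gb := gibbs (pmf_ge0 P' sab) q_ge0 (sum_pmf P' m_sab) sum_q q_gt0.
apply: (@le_trans _ _ (\sum_u pmf P' sab u * - log2 (Q u.1))).
  rewrite -subr_ge0 -sumrB; rewrite -subr_ge0 -sumrB in gb.
  rewrite (eq_bigr (fun u => pmf P' sab u * - log2 (q u) -
    pmf P' sab u * - log2 (pmf P' sab u)))// => u _.
  have := pmf_ge0 P' sab u; rewrite le_eqVlt => /predU1P[<-|h].
    by rewrite !mul0r.
  have [? ?] := sab_gt0 _ h.
  by rewrite /q -/(pab _) log2_div// log2M//; ring.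
rewrite (expect_comp P' fst (fun v => - log2 (Q v)) m_sab).
(* Pass to the joint law of [s] and the quadruple, where [Q] and [N] can be compared atom by
   atom. *)
rewrite -[X in X <= _]/(\sum_v pmf P' (fst \o (fun t => (s t, tot t))) v * - log2 (Q v)).
rewrite -(expect_comp P' fst (fun v => - log2 (Q v)) m_st).
apply: (@le_trans _ _ (\sum_u pmf P' (fun t => (s t, tot t)) u *
    (- log2 (N u.2.1.1 u.2.2.2) + log2 (M ^+ 2 * C)))).
  apply: ler_sum => -[v u] _ /=.
  have := pmf_ge0 P' (fun t => (s t, tot t)) (v, u).
  rewrite le_eqVlt => /predU1P[<-|h]; first by rewrite !mul0r.
  have /andP[N0 NleQ] := NQ _ _ h.
  rewrite ler_wpM2l ?(ltW h)//.
  have := ler_log2 N0 NleQ; rewrite log2M ?(Q_gt0 _ _ h)//; lra.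
under eq_bigr do rewrite mulrDr.
rewrite big_split/= -[X in _ + X]mulr_suml (sum_pmf P' m_st) mul1r lerD2r.
rewrite (expect_comp P' snd (fun u => - log2 (N u.1.1 u.2.2)) m_st).
exact: expect_N.
Qed.

End EntropyInequality.

(** * Discretization and bi-Lipschitz maps *)

Section Discretization.
Context {R : realType}.

Lemma measurable_floor_level d (T : measurableType d) (g : T -> R) :
  measurable_fun setT g -> finite_rv (fun w => Num.floor (g w)).
Proof.
move=> mg z; have := measurable_preimage mg (measurable_itv `[z%:~R, (z + 1)%:~R[).
congr (measurable _); apply/seteqP; split=> w /=; rewrite inE/= in_itv/=.
  by rewrite -floor_eq => /eqP.
by move=> <-; exact: floor_itv.
Qed.

(** [D] may be non-measurable and [f] arbitrary off [D]. By the Lipschitz bound, the open union [U]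
    of balls of radius [(f x - a) / L] meets [D] exactly where [f > a]. *)
Lemma measurable_lipschitz_comp d (T : measurableType d) (L : R) (D : set R)
    (f : R -> R) (X : T -> R) :
  0 < L -> (forall x y, D x -> D y -> `|f x - f y| <= L * `|x - y|) ->
  measurable_fun setT X -> (forall w, D (X w)) -> measurable_fun setT (f \o X).
Proof.
move=> L0 fL mX DX; apply: (measurability _ (RGenOInfty.measurableE R)) => //.
move=> _ [_ [a ->] <-]; rewrite setTI.
pose U := \bigcup_(x in D `&` [set x | a < f x]) ball x ((f x - a) / L).
have mU : measurable U.
  apply: open_measurable; apply: bigcup_open => x [_ ax].
  by apply: ball_open; rewrite divr_gt0// subr_gt0.
have := measurable_preimage mX mU; congr (measurable _).
apply/seteqP; split=> w /=; rewrite inE /U /= in_itv/= andbT.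
- move=> [x [Dx ax]]; rewrite /ball/= ltr_pdivlMr// mulrC => xw.
  have := fL _ _ Dx (DX w); rewrite ler_distlC => /andP[+ _].
  by apply: lt_le_trans; lra.
- move=> aw; exists (X w) => //; apply: ballxx.
  by rewrite divr_gt0// subr_gt0.
Qed.

(** The index type is the finite range of [k]; surjectivity is recorded so that each cell has a
    representative. *)
Lemma finite_level_index d (T : measurableType d) (k : T -> int) (B : nat) :
  (forall w, (`|k w| <= B)%N) -> finite_rv k ->
  exists (I : finType) (ix : T -> I) (e : I -> int),
    [/\ injective e, (forall w, e (ix w) = k w),
        (forall i, exists w, ix w = i) & finite_rv ix].
Proof.
move=> kB mk; have fk : finite_set (range k).
  apply: (@sub_finite_set _ _ ((fun i : nat => i%:Z - B%:Z) @` `I_(B + B).+1)).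
    move=> _ [w _ <-]; exists (absz (k w + B%:Z)) => /=; have := kB w; lia.
  exact/finite_image/finite_II.
pose A := fset_set (range k).
have kA w : k w \in A by rewrite in_fset_set// inE; exists w.
exists A, (fun w => FSetSub (kA w)), (fun i => fsval i); split=> //.
- exact: val_inj.
- move=> i; have : fsval i \in A by exact: fsvalP.
  rewrite in_fset_set// inE => -[w _ kw]; exists w; exact: val_inj.
- move=> i; have := mk (fsval i); congr (measurable _).
  apply/seteqP; split=> w /=; first by move=> kw; exact: val_inj.
  by move=> <-.
Qed.

(** Subtracting the least value of [h] on [A] injects [A] into the integers from 0 to the integer
    part of [D]. *)
Lemma sum_close_le (J : finType) (A : pred J) (h : J -> int) (D : R) : 0 <= D ->
  {in A &, injective h} ->
  (forall i j, A i -> A j -> `|(h i)%:~R - (h j)%:~R| <= D) ->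
  \sum_j (A j)%:R <= D + 1.
Proof.
move=> D0 injh hD; rewrite -natr_sum (_ : (\sum_j A j)%N = #|[set j | A j]%SET|); last first.
  by rewrite -sum1dep_card [RHS]big_mkcond; apply: eq_bigr => j _; case: (A j).
have [A0|[j0 Aj0]] := set_0Vmem [set j | A j]%SET.
  by rewrite A0 cards0 addr_ge0.
rewrite inE in Aj0.
case: (@Order.TotalTheory.arg_minP _ _ _ j0 A h Aj0) => i Ai imin.
pose m := Num.truncn D.
pose F j : 'I_m.+1 := inord (absz (h j - h i)).
have Fh j : A j -> (h j - h i)%:~R <= D /\ h i <= h j.
  move=> Aj; split; last exact: imin.
  by have := hD _ _ Aj Ai; rewrite ler_norml rmorphB => /andP[].
have Fm j : A j -> (absz (h j - h i) < m.+1)%N.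
  move=> /Fh[hD' ij]; rewrite ltnS truncn_ge_nat// natr_absz.
  by rewrite ger0_norm ?subr_ge0.
have injF : {in [set j | A j]%SET &, injective F}.
  move=> j k; rewrite !inE => Aj Ak /(congr1 val) /=.
  rewrite !inordK ?Fm// => e; apply: injh => //.
  have [_ ?] := Fh j Aj; have [_ ?] := Fh k Ak; lia.
rewrite -(card_in_imset injF).
apply: (@le_trans _ _ (m.+1%:R)).
  by rewrite ler_nat (leq_trans (max_card _))// card_ord.
by rewrite -natr1 lerD2r truncn_le.
Qed.

Lemma dist_floor_le (x y : R) : `|(Num.floor x)%:~R - (Num.floor y)%:~R| <= `|x - y| + 1.
Proof.
have := floor_itv x; have := floor_itv y; rewrite !intrD.
move=> /andP[? ?] /andP[? ?]; have := ler_norm (x - y); have := ler_norm (y - x).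
by rewrite (distrC y) => ? ?; rewrite ler_norml; apply/andP; split; lra.
Qed.

Lemma floor_index d (T : measurableType d) (g : T -> R) :
  measurable_fun setT g -> (exists M, forall w, `|g w| <= M) ->
  exists (I : finType) (ix : T -> I) (e : I -> int),
    [/\ injective e, (forall w, e (ix w) = Num.floor (g w)),
        (forall i, exists w, ix w = i) & finite_rv ix].
Proof.
move=> mg [M gM]; apply: (@finite_level_index _ _ _ (Num.truncn (M + 1))); last first.
  exact: measurable_floor_level.
move=> w; have M0 : 0 <= M by exact: le_trans (gM w).
rewrite truncn_ge_nat ?addr_ge0// natr_absz intr_norm.
have := dist_floor_le (g w) 0; rewrite floor0 !subr0 => /le_trans; apply.
by rewrite lerD2r.
Qed.

Lemma grid_inj (I : Type) (e : I -> int) (n : nat) :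
  injective e -> injective (fun i => (e i)%:~R / 2 ^+ n : R).
Proof.
move=> injE i j /(congr1 (fun x => x * 2 ^+ n)).
by rewrite !divfK ?expf_neq0// => /eqP; rewrite eqr_int => /eqP /injE.
Qed.

Lemma grid_pair_inj (I J : Type) (e : I -> int) (h : J -> int) (n : nat) :
  injective e -> injective h ->
  injective (fun u => ((e u.1)%:~R / 2 ^+ n : R, (h u.2)%:~R / 2 ^+ n : R)).
Proof.
move=> injE injh [i j] [k l] [] /= eik hjl.
by congr pair; [exact: (grid_inj injE eik)|exact: (grid_inj injh hjl)].
Qed.

End Discretization.

(** * Rounding errors and multiplicities for weakly bi-Lipschitz functions *)

Section BiLipschitz.
Context {R : realType}.
Variables (N : nat) (kappa : R) (D : set R) (f : R -> R) (n : nat).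
Hypothesis kappa_ge2 : 2 <= kappa.
Hypothesis fD : weakly_biLipschitz N kappa D f.

Let scale_dist (x y : R) : `|2 ^+ n * x - 2 ^+ n * y| = 2 ^+ n * `|x - y|.
Proof. by rewrite -mulrBr normrM ger0_norm. Qed.

Lemma biLipschitz_near (x y : R) : D x -> D y ->
  Num.floor (2 ^+ n * x) = Num.floor (2 ^+ n * y) ->
  `|2 ^+ n * f x - 2 ^+ n * f y| <= kappa.
Proof.
move=> Dx Dy xy; rewrite scale_dist.
apply: (@le_trans _ _ (2 ^+ n * (kappa * `|x - y|))).
  by rewrite ler_wpM2l//; exact: fD.1.
rewrite mulrCA ger_pMr ?(lt_le_trans _ kappa_ge2)//.
rewrite -scale_dist ler_norml.
have := floor_itv (2 ^+ n * x); have := floor_itv (2 ^+ n * y).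
by rewrite xy !intrD => /andP[? ?] /andP[? ?]; apply/andP; split; lra.
Qed.

(** On one piece, images within [r] of [t] come from rescaled points at distance at most
    [2 * r * kappa]. Taking floors adds 1, counting integers adds another, and there are [N]
    pieces. *)
Lemma biLipschitz_count (I : finType) (x : I -> R) (e : I -> int) (r t : R) :
  0 <= r -> injective e -> (forall i, D (x i)) ->
  (forall i, Num.floor (2 ^+ n * x i) = e i) ->
  \sum_i (`|2 ^+ n * f (x i) - t| <= r)%R%:R <= N%:R * (2 * r * kappa + 2).
Proof.
move=> r0 injE Dx xe; have [_ [Pc [DPc [_ Pcf]]]] := fD.
pose A c i := `[< Pc c (x i) >] && (`|2 ^+ n * f (x i) - t| <= r).
apply: (@le_trans _ _ (\sum_i \sum_(c < N) (A c i)%:R)).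
  apply: ler_sum => i _; have := Dx i; rewrite DPc => -[c _ Pci].
  rewrite (bigD1 c)//= /A (asboolT Pci)/= lerDl; exact: sumr_ge0.
rewrite exchange_big/= -[N in N%:R]card_ord -sum1_card natr_sum mulr_suml.
apply: ler_sum => c _; rewrite mul1r.
have -> : 2 * r * kappa + 2 = 2 * r * kappa + 1 + 1 by lra.
have kr : 0 <= r * kappa by rewrite mulr_ge0// (le_trans _ kappa_ge2).
apply: (@sum_close_le _ _ _ e); [lra|by move=> i j _ _; exact: injE|].
move=> i j /andP[/asboolP Pi fi] /andP[/asboolP Pj fj].
rewrite -!xe (le_trans (dist_floor_le _ _))// lerD2r scale_dist.
apply: (@le_trans _ _ (2 ^+ n * (kappa * `|f (x i) - f (x j)|))).
  by rewrite ler_wpM2l//; exact: Pcf Pi Pj.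
rewrite mulrCA -scale_dist [leRHS]mulrC ler_wpM2l ?(le_trans _ kappa_ge2)//.
move: fi fj; rewrite !ler_distl => /andP[? ?] /andP[? ?].
by apply/andP; split; lra.
Qed.

End BiLipschitz.

(** * The quadruple *)

(* w.1.1, w.1.2 and w.2 carry (X', Y'), X'' and Y'' respectively. *)
Section CoupledChain.
Context {R : realType} d {T : measurableType d} (P : probability T R).
Variables (I J : finType) (ix : T -> I) (iy : T -> J).
Hypotheses (m_ix : finite_rv ix) (m_iy : finite_rv iy).

Variable Q : probability (T * T)%type R.
Hypothesis couplQ : is_coupling P P iy iy Q.
Variable P' : probability (T * T * T)%type R.
Hypothesis couplP' : is_coupling Q P (ix \o fst) ix P'.

Let pxy i j := pr P ([set t | ix t = i] `&` [set t | iy t = j]).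

Let m_ixf : finite_rv (ix \o fst : T * T -> I) :=
  finite_rv_measurable_comp measurable_fst m_ix.

(** The matching condition under which a second coupling can attach [Y''] along the cell of [X']. *)
Lemma chain_law : pmf Q (ix \o fst) =1 pmf P ix.
Proof.
move=> i; rewrite -[RHS](coupling_fst m_iy (frefl _) couplQ)//.
by congr (pr Q _); apply/seteqP; split=> w /=; tauto.
Qed.

Lemma chain_fst (S : set T) : measurable S -> pr P' [set w | S w.1.1] = pr P S.
Proof.
move=> mS; rewrite -(coupling_fst m_iy (frefl _) couplQ mS).
rewrite -(coupling_fst m_ixf chain_law couplP'); last exact: measurableX.
by congr (pr P' _); apply/seteqP; split=> w /=; tauto.
Qed.

(** Two applications of the slice formula: given the cells of [(X', Y')], the other two draws are
    independent, one governed by [j] and the other by [i]. *)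
Lemma chain_slice (E1 E2 : set T) i j : measurable E1 -> measurable E2 ->
  pr P' [set w | [/\ ix w.1.1 = i, iy w.1.1 = j, E1 w.1.2 & E2 w.2]] =
  pxy i j * (pr P (E1 `&` [set t | iy t = j]) / pmf P iy j) *
  (pr P (E2 `&` [set t | ix t = i]) / pmf P ix i).
Proof.
move=> mE1 mE2; have mij := measurableI _ _ (m_ix i) (m_iy j).
rewrite [X in pr P' X](_ : _ =
    (([set t | ix t = i] `&` [set t | iy t = j]) `*` E1) `*` E2); last first.
  by apply/seteqP; split=> w /=; [move=> [? ? ? ?]|move=> [[[? ?] ?] ?]].
have mijE := measurableX mij mE1.
rewrite (coupling_slice couplP' (i := i))//; last by move=> w [[]].
rewrite (coupling_slice couplQ (i := j))//.
by rewrite !mulrA.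
Qed.

(** An unconstrained draw contributes the factor one; over a null cell the quotient is 0, but then
    [pxy i j] is 0 as well. *)
Lemma chain_sliceT1 i j : pxy i j * (pr P (setT `&` [set t | iy t = j]) / pmf P iy j) = pxy i j.
Proof.
rewrite setTI -/(pmf _ _ _); have [j0|j0] := eqVneq (pmf P iy j) 0; last first.
  by rewrite mulfV// mulr1.
suff -> : pxy i j = 0 by rewrite mul0r.
apply/eqP; rewrite eq_le pr_ge0 andbT -j0.
by apply: pr_le; [exact: measurableI|exact: m_iy|exact: subIsetr].
Qed.

Lemma chain_sliceT2 i j : pxy i j * (pr P (setT `&` [set t | ix t = i]) / pmf P ix i) = pxy i j.
Proof.
rewrite setTI -/(pmf _ _ _); have [i0|i0] := eqVneq (pmf P ix i) 0; last first.
  by rewrite mulfV// mulr1.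
suff -> : pxy i j = 0 by rewrite mul0r.
apply/eqP; rewrite eq_le pr_ge0 andbT -i0.
by apply: pr_le; [exact: measurableI|exact: m_ix|exact: subIsetl].
Qed.

Lemma pmf_pairE i j : pmf P (fun t => (ix t, iy t)) (i, j) = pxy i j.
Proof.
by congr (pr P _); apply/seteqP; split=> t /=; [move=> [-> ->]|move=> [-> ->]].
Qed.

Let a2 (w : T * T * T) := ix w.1.2.
Let a1 (w : T * T * T) := ix w.1.1.
Let b1 (w : T * T * T) := iy w.1.1.
Let b3 (w : T * T * T) := iy w.2.

Lemma chain_law11 : pmf P' (fun w => (a1 w, b1 w)) =1 pmf P (fun t => (ix t, iy t)).
Proof.
by move=> u; rewrite -[RHS]chain_fst//; exact: (finite_rv_pair m_ix m_iy).
Qed.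

Lemma chain_law21 : pmf P' (fun w => (a2 w, b1 w)) =1 pmf P (fun t => (ix t, iy t)).
Proof.
move=> [i j]; rewrite pmf_pairE /pxy -(coupling_law m_iy m_iy (frefl _) couplQ)//.
rewrite -(coupling_fst m_ixf chain_law couplP'); last exact: measurableX.
congr (pr P' _); apply/seteqP; split=> w /=; first by move=> [<- <-].
by move=> [[<- <-]].
Qed.

Lemma chain_law13 : pmf P' (fun w => (a1 w, b3 w)) =1 pmf P (fun t => (ix t, iy t)).
Proof.
move=> [i j]; rewrite pmf_pairE /pxy setIC -(coupling_law m_ixf m_ix chain_law couplP')//.
congr (pr P' _); apply/seteqP; split=> w /=; first by move=> [<- <-].
by move=> [<- <-].
Qed.

Lemma chain_law_tot i j k l : pmf P' (fun w => ((a2 w, b1 w), (a1 w, b3 w))) ((i, j), (k, l)) =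
  pmf P (fun t => (ix t, iy t)) (i, j) * pmf P (fun t => (ix t, iy t)) (k, j) *
  pmf P (fun t => (ix t, iy t)) (k, l) / (pmf P iy j * pmf P ix k).
Proof.
rewrite /pmf [X in pr P' X](_ : _ = [set w | [/\ ix w.1.1 = k, iy w.1.1 = j,
    [set t | ix t = i] w.1.2 & [set t | iy t = l] w.2]]); last first.
  by apply/seteqP; split=> w /=; [move=> [<- <- <- <-]|move=> [<- <- <- <-]].
rewrite chain_slice// -!/(pmf _ _ _) !pmf_pairE /pxy [X in _ * (pr P X / _)]setIC invfM.
by ring.
Qed.

(** The Markov hypothesis of [markov_cond_entropy] with [h := snd]: [X''] sees [(X', Y')] only
    through the cell of [Y']. *)
Lemma chain_law_a2 i k j : pmf P' (fun w => (a2 w, (a1 w, b1 w))) (i, (k, j)) =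
  pmf P' (fun w => (a1 w, b1 w)) (k, j) *
  (pmf P' (fun w => (a2 w, b1 w)) (i, j) / pmf P' b1 j).
Proof.
rewrite chain_law11 chain_law21 !pmf_pairE.
rewrite {1}/pmf [X in pr P' X = _](_ : _ = [set w | [/\ ix w.1.1 = k, iy w.1.1 = j,
    [set t | ix t = i] w.1.2 & setT w.2]]); last first.
  by apply/seteqP; split=> w /=; [move=> [<- <- <-]|move=> [<- <- <- _]].
rewrite chain_slice// mulrAC chain_sliceT2; congr (_ * (_ / _)).
by rewrite -[LHS]chain_fst.
Qed.

Lemma chain_law_b3 l k j : pmf P' (fun w => (b3 w, (a1 w, b1 w))) (l, (k, j)) =
  pmf P' (fun w => (a1 w, b1 w)) (k, j) *
  (pmf P' (fun w => (b3 w, a1 w)) (l, k) / pmf P' a1 k).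
Proof.
rewrite chain_law11 !pmf_pairE.
rewrite {1}/pmf [X in pr P' X = _](_ : _ = [set w | [/\ ix w.1.1 = k, iy w.1.1 = j,
    setT w.1.2 & [set t | iy t = l] w.2]]); last first.
  by apply/seteqP; split=> w /=; [move=> [<- <- <-]|move=> [<- <- _ <-]].
rewrite chain_slice// chain_sliceT1; congr (_ * (_ / _)); last by rewrite -[LHS]chain_fst.
rewrite -(coupling_law m_ixf m_ix chain_law couplP')//.
by congr (pr P' _); apply/seteqP; split=> w /=; [move=> [<- <-]|move=> [<- <-]].
Qed.

Lemma chain_cond_indep d1 d2 (U1 : measurableType d1)
    (U2 : measurableType d2) (X : T -> U1) (Y : T -> U2) (W : Type) (e : I * J -> W) :
  measurable_fun setT X -> measurable_fun setT Y -> injective e ->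
  cond_indep P' (fun w => X w.1.2) (fun w => Y w.2) (fun w => e (a1 w, b1 w)).
Proof.
move=> mX mY injE c A1 A2 mA1 mA2.
have mV1 := measurable_preimage mX mA1; have mV2 := measurable_preimage mY mA2.
case: (inj_comp_level (fun w => (a1 w, b1 w)) c injE) => [nc|[[i j] ci]].
  have pr_c0 S : S `<=` [set w | e (a1 w, b1 w) = c] -> pr P' S = 0.
    move=> Sc; rewrite (_ : S = set0) ?pr0//.
    by apply/seteqP; split=> w // /Sc /nc.
  rewrite [X in _ * X = _]pr_c0// [X in _ = X * _]pr_c0 ?mulr0 ?mul0r//.
  by move=> w [].
have ci' w : (e (a1 w, b1 w) = c) = (a1 w = i /\ b1 w = j).
  by rewrite ci; apply/propext; split=> [[]//|[-> ->]].
rewrite [X in pr P' X * _ = _](_ : _ = [set w | [/\ ix w.1.1 = i, iy w.1.1 = j,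
    [set t | X t \in A1] w.1.2 & [set t | Y t \in A2] w.2]]); last first.
  by apply/seteqP; split=> w /=; rewrite ci' /a1 /b1; [move=> [? [? [? ?]]]|move=> [? ? ? ?]].
rewrite [X in _ * pr P' X = _](_ : _ = [set w | [/\ ix w.1.1 = i, iy w.1.1 = j,
    setT w.1.2 & setT w.2]]); last first.
  by apply/seteqP; split=> w /=; rewrite ci' /a1 /b1; [move=> [? ?]|move=> [? ? _ _]].
rewrite [X in _ = pr P' X * _](_ : _ = [set w | [/\ ix w.1.1 = i, iy w.1.1 = j,
    [set t | X t \in A1] w.1.2 & setT w.2]]); last first.
  by apply/seteqP; split=> w /=; rewrite ci' /a1 /b1; [move=> [? [? ?]]|move=> [? ? ? _]].
rewrite [X in _ = _ * pr P' X](_ : _ = [set w | [/\ ix w.1.1 = i, iy w.1.1 = j,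
    setT w.1.2 & [set t | Y t \in A2] w.2]]); last first.
  by apply/seteqP; split=> w /=; rewrite ci' /a1 /b1; [move=> [? [? ?]]|move=> [? ? _ ?]].
rewrite !chain_slice// [X in _ = X * _]mulrAC !chain_sliceT1 !chain_sliceT2.
by ring.
Qed.

End CoupledChain.

(* M and 2 * (4 * r) + 1 are the bounds given by biLipschitz_count and sum_close_le. *)
Lemma log2_multiplicity_le {R : realType} (N : nat) (kappa r M : R) : (0 < N)%N -> 2 <= kappa ->
  r = 2 * kappa + 1 -> M = N%:R * (2 * r * kappa + 2) ->
  0 < M /\ log2 (M ^+ 2 * (2 * (4 * r) + 1)) <= (2 * N + 16)%:R * log2 kappa.
Proof.
move=> N0 k2 -> ->; have k0 : 0 < kappa by lra.
set A := 2 * (2 * kappa + 1) * kappa + 2; set B := 2 * (4 * _) + 1.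
have A0 : 0 < A by rewrite /A; nra.
have B0 : 0 < B by rewrite /B; lra.
have N0' : 0 < N%:R :> R by rewrite ltr0n.
have M0 : 0 < N%:R * A by rewrite mulr_gt0.
split=> //; rewrite -log2X//; apply: ler_log2; first by rewrite mulr_gt0// exprn_gt0.
(* With [kappa >= 2], the factors [N], [A] and [B] are at most [kappa] to the powers [N], 5 and 6,
   whence the exponent [2 * (N + 5) + 6]. *)
have NkN : N%:R <= kappa ^+ N.
  apply: (@le_trans _ _ (2 ^+ N)); first by rewrite -natrX ler_nat ltnW// ltn_expl.
  by apply: lerXn2r; rewrite ?nnegrE// ltW.
have A5 : A <= kappa ^+ 5.
  have k3 : 2 ^+ 3 <= kappa ^+ 3 by apply: lerXn2r; rewrite ?nnegrE// ltW.
  have -> : kappa ^+ 5 = kappa ^+ 3 * kappa ^+ 2 by ring.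
  apply: (@le_trans _ _ (2 ^+ 3 * kappa ^+ 2)); first by rewrite /A; nra.
  by rewrite ler_wpM2r ?exprn_ge0// ltW.
have B6 : B <= kappa ^+ 6.
  have k5 : 2 ^+ 5 <= kappa ^+ 5 by apply: lerXn2r; rewrite ?nnegrE// ltW.
  have -> : kappa ^+ 6 = kappa ^+ 5 * kappa by ring.
  apply: (@le_trans _ _ (2 ^+ 5 * kappa)); first by rewrite /B; lra.
  by rewrite ler_wpM2r// ltW.
have -> : kappa ^+ (2 * N + 16) = (kappa ^+ N * kappa ^+ 5) ^+ 2 * kappa ^+ 6.
  by rewrite !exprMn -!exprM -!exprD; congr (_ ^+ _); lia.
have k0' := ltW k0.
apply: ler_pM => //; [exact/exprn_ge0/ltW|exact: ltW|].
apply: lerXn2r; rewrite ?nnegrE ?(ltW M0) ?mulr_ge0 ?exprn_ge0//.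
by apply: ler_pM => //; exact: ltW.
Qed.

(** * Construction of the quadruple and verification of its properties *)

Theorem theorem3p1 (N : nat) :
  exists K : nat,
  forall (R : realType) (n : nat) (d : measure_display) (T : measurableType d)
    (P : probability T R) (X Y : T -> R) (K1 : R),
  measurable_fun setT X -> measurable_fun setT Y ->
  (exists M : R, forall w, `|X w| <= M /\ `|Y w| <= M) ->
  1 <= K1 ->
  (Hn P n X + Hn P n Y - Hn2 P n X Y <= (log2 K1)%:E)%E ->
  exists (d' : measure_display) (T' : measurableType d') (P' : probability T' R)
         (X'' Y' X' Y'' : T' -> R),
    [/\ measurable_fun setT X'', measurable_fun setT Y',
        measurable_fun setT X' & measurable_fun setT Y''] /\
    (* (i) (X',Y') has the same distribution as (X,Y) *)
    (forall A : set (R * R), measurable A ->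
       P' [set w | (X' w, Y' w) \in A] = P [set w | (X w, Y w) \in A]) /\
    (* (ii) *)
    cond_iid P' X' X'' (fun w => Dn n (Y' w)) /\
    (* (iii) *)
    cond_iid P' Y' Y'' (fun w => Dn n (X' w)) /\
    (* (iv) *)
    cond_indep P' (fun w => (X'' w, Y' w)) Y'' (fun w => Dn n (X' w)) /\
    (* in particular *)
    cond_indep P' X'' Y'' (fun w => (Dn n (X' w), Dn n (Y' w))) /\
    (Hn_cond2 P' n X'' X' Y' >= Hn P n X - (log2 K1)%:E)%E /\
    (Hn_cond2 P' n Y'' X' Y' >= Hn P n Y - (log2 K1)%:E)%E /\
    (forall (kappa K2 : R) (Df Dg : set R) (f g : R -> R),
       2 <= kappa -> 1 <= K2 ->
       (forall w, Df (X w)) -> (forall w, Dg (Y w)) ->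
       weakly_biLipschitz N kappa Df f -> weakly_biLipschitz N kappa Dg g ->
       (Hn P n (fun w => (f (X w) + g (Y w))%R) - (Hn P n X + Hn P n Y) * (2^-1)%:E
          <= (log2 K2)%:E)%E ->
       (Hn_cond2 P' n (fun w => (f (X'' w) + g (Y'' w))%R) X' Y'
          - (Hn P n X + Hn P n Y) * (2^-1)%:E
          <= (4 * log2 K1 + 3 * log2 K2 + K%:R * log2 kappa)%:E)%E).
Proof.
exists (2 * N + 16)%N => R n d T P X Y K1 mX mY [M XYM] K1_ge1.
have m_scale (d0 : measure_display) (S : measurableType d0) (h : S -> R) :
    measurable_fun setT h -> measurable_fun setT (fun w => 2 ^+ n * h w).
  by move=> mh; exact: measurable_funM.
have b_scale (S : Type) (h : S -> R) (B : R) : (forall w, `|h w| <= B) ->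
    exists M' : R, forall w, `|2 ^+ n * h w| <= M'.
  by move=> hB; exists (2 ^+ n * B) => w; rewrite normrM ger0_norm// ler_wpM2l.
have [I [ix [ex [injx exE surx m_ix]]]] :=
  floor_index (m_scale _ _ _ mX) (b_scale _ _ _ (fun w => (XYM w).1)).
have [J [iy [ey [injy eyE sury m_iy]]]] :=
  floor_index (m_scale _ _ _ mY) (b_scale _ _ _ (fun w => (XYM w).2)).
pose eX i : R := (ex i)%:~R / 2 ^+ n; pose eY j : R := (ey j)%:~R / 2 ^+ n.
have injX : injective eX by exact: grid_inj.
have injY : injective eY by exact: grid_inj.
have injXY : injective (fun u => (eX u.1, eY u.2)) by exact: grid_pair_inj.
have DX w : Dn n (X w) = eX (ix w) by rewrite /Dn -exE.
have DY w : Dn n (Y w) = eY (iy w) by rewrite /Dn -eyE.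
have m_ixy := finite_rv_pair m_ix m_iy.
have HX : Hn P n X = (ent P ix)%:E.
  by rewrite -(entropyE P m_ix injX); congr entropy; apply/funext.
have HY : Hn P n Y = (ent P iy)%:E.
  by rewrite -(entropyE P m_iy injY); congr entropy; apply/funext.
have HXY : Hn2 P n X Y = (ent P (fun w => (ix w, iy w)))%:E.
  rewrite -(entropyE P m_ixy injXY); congr entropy.
  by apply/funext => w; rewrite DX DY.
rewrite HX HY HXY -EFinD -EFinB lee_fin => hK1.
(* [Q] attaches the draw for [X''] along the cell of [Y']; then [P'] attaches the draw for [Y'']
   along the cell of [X']. *)
have [Q couplQ] := coupling_exists m_iy m_iy (frefl (pmf P iy)).
have m_fst : measurable_fun setT (fst : T * T -> T) := measurable_fst.
have m_ixf := finite_rv_measurable_comp m_fst m_ix.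
have lawQ := chain_law m_ix m_iy couplQ.
have [P' couplP'] := coupling_exists m_ixf m_ix lawQ.
have m_snd : measurable_fun setT (snd : T * T -> T) := measurable_snd.
have m_11 : measurable_fun setT (fun w : T * T * T => w.1.1).
  by apply: (measurableT_comp m_fst); exact: measurable_fst.
have m_12 : measurable_fun setT (fun w : T * T * T => w.1.2).
  by apply: (measurableT_comp m_snd); exact: measurable_fst.
have m_2 : measurable_fun setT (fun w : T * T * T => w.2) := measurable_snd.
exists _, (T * T * T)%type, P', (fun w => X w.1.2), (fun w => Y w.1.1),
  (fun w => X w.1.1), (fun w => Y w.2).
have mX12 := measurableT_comp mX m_12.
have mX11 := measurableT_comp mX m_11.
have mY11 := measurableT_comp mY m_11.
have mY2 := measurableT_comp mY m_2.
have DX11 : (fun w : T * T * T => Dn n (X w.1.1)) = eX \o (ix \o fst) \o fst.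
  by apply/funext => w; rewrite DX.
have DY11 : (fun w : T * T * T => Dn n (Y w.1.1)) = eY \o (iy \o fst) \o fst.
  by apply/funext => w; rewrite DY.
have DXY11 : (fun w : T * T * T => (Dn n (X w.1.1), Dn n (Y w.1.1))) =
    (fun u => (eX u.1, eY u.2)) \o (fun w => (ix w.1.1, iy w.1.1)).
  by apply/funext => w; rewrite /= DX DY.
split; first by split.
split.
  move=> A mA; have mS := measurable_preimage (measurable_fun_pair mX mY) mA.
  have mS' := measurable_preimage (measurable_fun_pair mX11 mY11) mA.
  rewrite (prE P' mS') (prE P mS); congr (_%:E).
  exact: (chain_fst m_ix m_iy couplQ couplP' mS).
split.
  rewrite DY11.
  apply: (cond_iid_fst m_ixf lawQ couplP' (U1 := X \o fst) (U2 := X \o snd)) => //.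
  - exact: measurableT_comp.
  - exact: measurableT_comp.
  - exact: finite_rv_measurable_comp m_fst m_iy.
  - exact: (coupling_cond_iid m_iy m_iy (frefl _) couplQ mX mX injY (fun _ _ _ => erefl)).
split.
  rewrite DX11.
  apply: (coupling_cond_iid m_ixf m_ix lawQ couplP' (U1 := Y \o fst)) => //.
    exact: measurableT_comp.
  move=> i A mA; have mV := measurable_preimage mY mA.
  rewrite -(coupling_fst m_iy (frefl _) couplQ); last exact: measurableI _ _ mV (m_ix i).
  by congr (pr Q _); apply/seteqP; split=> w /=; tauto.
split.
  rewrite DX11.
  (* Both [X''] and [Y'] live on the first factor of the outer coupling, so (iv) is its conditional
     independence. *)
  apply: (coupling_cond_indep m_ixf m_ix lawQ couplP'
    (U1 := fun w : T * T => (X w.2, Y w.1))) => //.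
  by apply: measurable_fun_pair; apply: measurableT_comp.
split.
  by rewrite DXY11; exact: (chain_cond_indep m_ix m_iy couplQ couplP' mX mY injXY).
have law11 := chain_law11 m_ix m_iy couplQ couplP'.
have law21 := chain_law21 m_ix m_iy couplQ couplP'.
have law13 := chain_law13 m_ix m_iy couplQ couplP'.
have law_tot := chain_law_tot m_ix m_iy couplQ couplP'.
have m_a1 := finite_rv_measurable_comp m_11 m_ix.
have m_b1 := finite_rv_measurable_comp m_11 m_iy.
have m_a2 := finite_rv_measurable_comp m_12 m_ix.
have m_b3 := finite_rv_measurable_comp m_2 m_iy.
have m_ab := finite_rv_pair m_a1 m_b1.
split.
  rewrite /Hn_cond2 DXY11.
  rewrite (_ : (fun w : T * T * T => Dn n (X w.1.2)) = eX \o (fun w => ix w.1.2)); last first.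
    by apply/funext => w; rewrite DX.
  rewrite (cond_entropyE P' m_a2 m_ab injX injXY).
  rewrite (markov_cond_entropy (h := snd) m_a2 m_ab); last first.
    by move=> i [k j]; exact: (chain_law_a2 m_ix m_iy couplQ couplP').
  (* The conditional entropy equals [H(X, Y) - H(Y)], and the hypothesis on [K1] bounds it from
     below. *)
  have -> : ent P' (fun w => (ix w.1.2, (ix w.1.1, iy w.1.1).2)) =
      ent P (fun w => (ix w, iy w)).
    by apply: eq_bigr => u _; rewrite -law21.
  have -> : ent P' (snd \o (fun w : T * T * T => (ix w.1.1, iy w.1.1))) = ent P iy.
    have law1 : pmf P' (snd \o (fun w : T * T * T => (ix w.1.1, iy w.1.1))) =1 pmf P iy.
      by move=> j; exact: (chain_fst m_ix m_iy couplQ couplP' (m_iy j)).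
    by apply: eq_bigr => j _; rewrite law1.
  by rewrite lee_fin; lra.
split.
  rewrite /Hn_cond2 DXY11.
  rewrite (_ : (fun w : T * T * T => Dn n (Y w.2)) = eY \o (fun w => iy w.2)); last first.
    by apply/funext => w; rewrite DY.
  rewrite (cond_entropyE P' m_b3 m_ab injY injXY).
  rewrite (markov_cond_entropy (h := fst) m_b3 m_ab); last first.
    by move=> l [k j]; exact: (chain_law_b3 m_ix m_iy couplQ couplP').
  have -> : ent P' (fun w => (iy w.2, (ix w.1.1, iy w.1.1).1)) =
      ent P (fun w => (ix w, iy w)).
    by rewrite (ent_swap P' (fun w => ix w.1.1)); apply: eq_bigr => u _; rewrite -law13.
  have -> : ent P' (fst \o (fun w : T * T * T => (ix w.1.1, iy w.1.1))) = ent P ix.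
    have law1 : pmf P' (fst \o (fun w : T * T * T => (ix w.1.1, iy w.1.1))) =1 pmf P ix.
      by move=> i; exact: (chain_fst m_ix m_iy couplQ couplP' (m_ix i)).
    by apply: eq_bigr => i _; rewrite law1.
  by rewrite lee_fin; lra.
move=> kappa K2 Df Dg f g k2 K2_ge1 DfX DgY lipf lipg.
(* A base point exists because [P] has mass one; it shows [0 < N] and anchors the bound on Lipschitz
   images. *)
have [w0 _] : exists w, [set: T] w.
  apply/set0P/eqP => T0; have := prT P; rewrite T0 pr0 => /eqP.
  by rewrite eq_sym oner_eq0.
have k0 : 0 < kappa by lra.
have N0 : (0 < N)%N.
  have [_ [Pc [DPc _]]] := lipf; have := DfX w0.
  by rewrite DPc => -[[c cN] _ _]; exact: leq_ltn_trans cN.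
have mf : measurable_fun setT (f \o X) := measurable_lipschitz_comp k0 lipf.1 mX DfX.
have mg : measurable_fun setT (g \o Y) := measurable_lipschitz_comp k0 lipg.1 mY DgY.
have b_lip (D : set R) (h : R -> R) (U : T -> R) :
    (forall x y, D x -> D y -> `|h x - h y| <= kappa * `|x - y|) ->
    (forall w, D (U w)) -> (forall w, `|U w| <= M) ->
    forall w, `|h (U w)| <= `|h (U w0)| + kappa * (M + M).
  move=> lip DU UM w; rewrite -[h (U w)](subrK (h (U w0))) addrC.
  rewrite (le_trans (ler_normD _ _))// lerD2l (le_trans (lip _ _ (DU w) (DU w0)))//.
  rewrite ler_wpM2l ?(ltW k0)// (le_trans (ler_normB _ _))// lerD//.
have bf := b_lip _ _ _ lipf.1 DfX (fun w => (XYM w).1).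
have bg := b_lip _ _ _ lipg.1 DgY (fun w => (XYM w).2).
have bfg w w' : `|f (X w) + g (Y w')| <= _ :=
  le_trans (ler_normD _ _) (lerD (bf w) (bg w')).
have mW : measurable_fun setT (fun w => f (X w) + g (Y w)) by exact: measurable_funD.
have mS : measurable_fun setT (fun w : T * T * T => f (X w.1.2) + g (Y w.2)).
  exact: measurable_funD (measurableT_comp mf m_12) (measurableT_comp mg m_2).
have [Z [iz [ez [injz ezE _ m_iz]]]] :=
  floor_index (m_scale _ _ _ mW) (b_scale _ _ _ (fun w => bfg w w)).
have [V [s [ev [injv evE _ m_s]]]] :=
  floor_index (m_scale _ _ _ mS) (b_scale _ _ _ (fun w : T * T * T => bfg w.1.2 w.2)).
have HW : Hn P n (fun w => f (X w) + g (Y w)) = (ent P iz)%:E.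
  rewrite -(entropyE P m_iz (grid_inj (R := R) (n := n) injz)); congr entropy.
  by apply/funext => w; rewrite /Dn -ezE.
rewrite HW -EFinM -EFinB lee_fin => hK2.
rewrite /Hn_cond2 DXY11.
rewrite (_ : (fun w : T * T * T => Dn n (f (X w.1.2) + g (Y w.2))) =
    (fun v => (ev v)%:~R / 2 ^+ n) \o s); last first.
  by apply/funext => w; rewrite /Dn -evE.
rewrite (cond_entropyE P' m_s m_ab (grid_inj (R := R) (n := n) injv) injXY).
rewrite -EFinB lee_fin.
have [rx rxE] := choice surx; have [ry ryE] := choice sury.
(* Passing to representatives costs [kappa] for each of [f] and [g], and the floor of the sum costs
   1. *)
pose r := 2 * kappa + 1; pose M' := N%:R * (2 * r * kappa + 2).
have r0 : 0 <= r by rewrite /r; lra.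
have [M'0 logM'] := log2_multiplicity_le N0 k2 (erefl r) (erefl M').
have rep_near w w' : `|(Num.floor (2 ^+ n * (f (X w) + g (Y w'))))%:~R -
    (2 ^+ n * f (X (rx (ix w))) + 2 ^+ n * g (Y (ry (iy w'))))| <= r.
  have fx : `|2 ^+ n * f (X w) - 2 ^+ n * f (X (rx (ix w)))| <= kappa.
    by apply: (biLipschitz_near k2 lipf) => //; rewrite -!exE rxE.
  have gy : `|2 ^+ n * g (Y w') - 2 ^+ n * g (Y (ry (iy w')))| <= kappa.
    by apply: (biLipschitz_near k2 lipg) => //; rewrite -!eyE ryE.
  have := floor_itv (2 ^+ n * (f (X w) + g (Y w'))); rewrite intrD mulrDr.
  move: fx gy; rewrite !ler_norml => /andP[? ?] /andP[? ?] /andP[? ?].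
  by apply/andP; split; rewrite /r; lra.
have := cond_entropy_sum_le m_ix m_iy m_iz m_a2 m_a1 m_b1 m_b3 m_s law21 law11 law13 law_tot
  (F := fun i => 2 ^+ n * f (X (rx i))) (G := fun j => 2 ^+ n * g (Y (ry j)))
  (zv := fun z => (ez z)%:~R) (sv := fun v => (ev v)%:~R) (r := r) (M := M')
  (C := 2 * (4 * r) + 1).
have count_f t : \sum_i (`|2 ^+ n * f (X (rx i)) - t| <= r)%R%:R <= M'.
  apply: (biLipschitz_count k2 lipf (x := X \o rx) t r0 injx) => i; first exact: DfX.
  by rewrite /= -exE rxE.
have count_g t : \sum_j (`|2 ^+ n * g (Y (ry j)) - t| <= r)%R%:R <= M'.
  apply: (biLipschitz_count k2 lipg (x := Y \o ry) t r0 injy) => j; first exact: DgY.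
  by rewrite /= -eyE ryE.
have count_s t : \sum_v (`|(ev v)%:~R - t| <= 4 * r)%R%:R <= 2 * (4 * r) + 1.
  apply: (@sum_close_le _ _ _ ev); first lra.
    by move=> u v _ _; exact: injv.
  move=> u v; rewrite !ler_distl => /andP[? ?] /andP[? ?].
  by apply/andP; split; lra.
have near_z w : `|(ez (iz w))%:~R -
    (2 ^+ n * f (X (rx (ix w))) + 2 ^+ n * g (Y (ry (iy w))))| <= r.
  by rewrite ezE; exact: rep_near.
have near_s w : `|(ev (s w))%:~R -
    (2 ^+ n * f (X (rx (ix w.1.2))) + 2 ^+ n * g (Y (ry (iy w.2))))| <= r.
  by rewrite evE; exact: rep_near.
have C0 : 0 < 2 * (4 * r) + 1 by lra.
move=> /(_ near_z near_s count_f count_g count_s M'0 C0) main.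
(* Inserting the hypothesis on [K2] leaves [3 * (H(X) + H(Y) - H(X, Y))], at most [3 * log2 K1],
   hence at most [4 * log2 K1]. *)
have lk1 := log2_ge0 K1_ge1.
apply: le_trans (lerD main (lexx _)) _.
lra.
Qed.
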